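(* Let $p > 2$ be a prime and let $m \ge 1$ be an integer. Every path in $\mathcal{C}^2_p$ starting in $(mp,p)$ has the initial part $$(mp,p) \longrightarrow (mp+1,p) \longrightarrow \cdots \longrightarrow (mp+p-2,p) \longrightarrow (mp+p-2,p,1).$$ For each two-part partition $\lambda \vdash n$ in this initial part (that is, $\lambda = (mp+s,p)$ with $0 \le s \le p-2$), the $p$-rank of $H^2(\Sigma_n,S^\lambda_{\mathbb{Z}})$ is $1$.
   Context: $\Sigma_n$ is the symmetric group on $n$ letters. $S^\lambda_{\mathbb{Z}}$ is the integral Specht module in James' convention (the $\mathbb{Z}\Sigma_n$-submodule of the permutation module on $\lambda$-tabloids spanned by polytabloids, so $S^{(n)}_{\mathbb{Z}}$ is trivial). $\mathcal{C}^2_p := \bigcup_{n \in \mathbb{Z}_{\ge 0}} \{\lambda \vdash n \mid p \text{ divides } |H^2(\Sigma_n,S^\lambda_{\mathbb{Z}})|\}$, regarded as a directed graph with an arrow $\lambda \to \mu$ (for $\lambda,\mu \in \mathcal{C}^2_p$) exactly when $\mu$ is obtained from $\lambda$ by adding one node; then $\lambda$ is called a predecessor of $\mu$ in $\mathcal{C}^2_p$. A path in $\mathcal{C}^2_p$ is an infinite simple directed path whose start vertex has no predecessor in $\mathcal{C}^2_p$. The $p$-rank of a finite abelian group is the number of direct summands $\mathbb{Z}/p\mathbb{Z}$ of its maximal elementary abelian $p$-subgroup. *)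

(* Defs.v *)
From HB Require Import structures.
From mathcomp Require Import all_boot all_order all_fingroup all_algebra.
From mathcomp Require Import ring_quotient.
From mathcomp Require Import boolp classical_sets functions cardinality.

Set Implicit Arguments.
Unset Strict Implicit.
Unset Printing Implicit Defensive.

Import GRing.Theory.
Local Open Scope ring_scope.

Lemma addrBACA (V : zmodType) (a a' b b' : V) :
  (a - a') + (b - b') = (a + b) - (a' + b').
Proof. by rewrite opprD addrACA. Qed.

Lemma subrBACA (V : zmodType) (a a' b b' : V) :
  (a - a') - (b - b') = (a - b) - (a' - b').
Proof. by rewrite (opprD b) addrACA -opprD. Qed.

(** * Group cohomology in degree two *)

(* Left modules over the integral group ring of a finite group. *)
Record gmodule (gT : finGroupType) := GModule {
  gmod_sort :> zmodType;
  gact : gT -> gmod_sort -> gmod_sort;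
  gactD : forall g u v, gact g (u + v) = gact g u + gact g v;
  gact1 : forall u, gact 1%g u = u;
  gactM : forall g h u, gact (g * h)%g u = gact g (gact h u) }.

Section Cohomology.
Variables (gT : finGroupType) (M : gmodule gT).

Lemma gactB (g : gT) (u v : M) : gact g (u - v) = gact g u - gact g v.
Proof. by apply: (addIr (gact g v)); rewrite -gactD !subrK. Qed.

Lemma gact0 (g : gT) : gact g (0 : M) = 0.
Proof. by have := gactB g 0 0; rewrite !subrr. Qed.

Definition cochain2 := {ffun gT * gT -> M}.
HB.instance Definition _ := GRing.Zmodule.on cochain2.

(* Inhomogeneous cochains, i.e. cochains for the bar resolution. *)
Definition cocycle2 : {pred cochain2} := fun c =>
  `[< forall g h k : gT,
      gact g (c (h, k)) - c ((g * h)%g, k) + c (g, (h * k)%g) - c (g, h) = 0 >].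

Lemma cocycle2_zmod_closed : zmod_closed cocycle2.
Proof.
split=> [|c d /asboolP Hc /asboolP Hd]; apply/asboolP => g h k.
  by rewrite !ffunE gact0 !subr0 addr0.
rewrite -[RHS](subr0 0) -{1}(Hc g h k) -(Hd g h k) !ffunE gactB.
by rewrite subrBACA addrBACA subrBACA.
Qed.
HB.instance Definition _ :=
  GRing.isZmodClosed.Build cochain2 cocycle2 cocycle2_zmod_closed.

Record Z2 := MkZ2 { Z2val :> cochain2; Z2valP : Z2val \in cocycle2 }.
HB.instance Definition _ := [isSub for Z2val].
HB.instance Definition _ := [Choice of Z2 by <:].
HB.instance Definition _ := [SubChoice_isSubZmodule of Z2 by <:].

Definition coboundary2 : {pred Z2} := fun c =>
  `[< exists b : {ffun gT -> M}, forall g h : gT,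
        val c (g, h) = gact g (b h) - b (g * h)%g + b g >].

Lemma coboundary2_zmod_closed : zmod_closed coboundary2.
Proof.
split=> [|c d /asboolP[b Hb] /asboolP[e He]]; apply/asboolP.
  by exists 0 => g h; rewrite raddf0 !ffunE gact0 subrr add0r.
exists (b - e) => g h; rewrite raddfB /= !ffunE Hb He gactB.
by rewrite subrBACA addrBACA.
Qed.
HB.instance Definition _ :=
  GRing.isZmodClosed.Build Z2 coboundary2 coboundary2_zmod_closed.

Definition H2 : zmodType := {ideal_quot coboundary2}.

End Cohomology.

(** * Order and p-rank of an abelian group *)

Definition dvd_order (p : nat) (A : zmodType) : Prop :=
  exists k : nat, ([set: A] #= `I_k)%card /\ (p %| k)%N.

Definition elementary_abelian (p : nat) (A : zmodType) (E : {pred A}) : Prop :=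
  zmod_closed E /\ {in E, forall x, x *+ p = 0}.

Definition max_elementary_abelian (p : nat) (A : zmodType) (E : {pred A}) :
    Prop :=
  elementary_abelian p E /\
  forall F : {pred A}, elementary_abelian p F -> {subset E <= F} -> F =i E.

(* The maximal elementary abelian p-subgroup is a direct sum of r copies of
   Z/p, realised as row vectors over 'F_p; meaningful for p prime. *)
Definition has_prank (p : nat) (A : zmodType) (r : nat) : Prop :=
  exists2 E : {pred A}, max_elementary_abelian p E &
  exists2 f : {additive 'rV['F_p]_r -> A},
    injective f & forall x, x \in E <-> exists v, f v = x.

(** * Integral Specht modules *)

Definition is_partition (lam : seq nat) : bool :=
  sorted geq lam && (0%N \notin lam).

Section Specht.
Variable lam : seq nat.
Local Notation n := (sumn lam).

(* Nodes of the Young diagram: a row i and a column j < lam_i. *)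
Definition node := {i : 'I_(size lam) & 'I_(nth 0%N lam i)}.
Definition node_row (b : node) : 'I_(size lam) := tag b.
Definition node_col (b : node) : nat := tagged b.

(* A tableau sends each letter to the node containing it; both sets have
   cardinality n, so that injections are bijections. *)
Definition tableau := {t : {ffun 'I_n -> node} | injectiveb t}.

Definition row_of (t : tableau) : {ffun 'I_n -> 'I_(size lam)} :=
  [ffun k => node_row (val t k)].

(* Two tableaux are row equivalent iff they have the same function row_of, so
   a tabloid is a value of this function. *)
Definition tabloid := {T | [exists t, row_of t == T]}.

Lemma tabloid_of_subproof (t : tableau) : [exists t', row_of t' == row_of t].
Proof. by apply/existsP; exists t. Qed.
Definition tabloid_of (t : tableau) : tabloid :=
  exist _ (row_of t) (tabloid_of_subproof t).

(* The product of permutations is (s * u) x = u (s x), for which permuting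
   letters by s is a right action.  We use the associated left action, where s
   replaces each letter k by s^-1 k. *)
Lemma tableau_act_subproof (s : 'S_n) (t : tableau) :
  injectiveb [ffun k => val t (s k)].
Proof.
apply/injectiveP => x y; rewrite !ffunE => /(injectiveP _ (valP t)).
exact: perm_inj.
Qed.
Definition tableau_act (s : 'S_n) (t : tableau) : tableau :=
  exist _ [ffun k => val t (s k)] (tableau_act_subproof s t).

Lemma tabloid_act_subproof (s : 'S_n) (T : tabloid) :
  [exists t, row_of t == [ffun k => val T (s k)]].
Proof.
have /existsP[t /eqP Ht] := valP T; apply/existsP; exists (tableau_act s t).
by apply/eqP/ffunP => k; rewrite -Ht !ffunE.
Qed.
Definition tabloid_act (s : 'S_n) (T : tabloid) : tabloid :=
  exist _ [ffun k => val T (s k)] (tabloid_act_subproof s T).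

(* The permutation module: the free Z-module on the tabloids. *)
Definition perm_module := {ffun tabloid -> int}.
HB.instance Definition _ := GRing.Zmodule.on perm_module.

Definition tabloid_vec (T : tabloid) : perm_module :=
  [ffun T' => (T' == T)%:R].

Definition perm_module_act (s : 'S_n) (v : perm_module) : perm_module :=
  [ffun T => v (tabloid_act s^-1 T)].

Definition column_stabiliser (t : tableau) : {set 'S_n} :=
  [set s : 'S_n | [forall k, node_col (val t (s k)) == node_col (val t k)]].

Definition polytabloid (t : tableau) : perm_module :=
  \sum_(s in column_stabiliser t)
     tabloid_vec (tabloid_of (tableau_act s t)) *~ ((-1) ^+ odd_perm s).

Definition specht_pred : {pred perm_module} := fun v =>
  `[< exists a : tableau -> int, v = \sum_t polytabloid t *~ a t >].

Lemma specht_zmod_closed : zmod_closed specht_pred.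
Proof.
split=> [|u v /asboolP[a ->] /asboolP[b ->]]; apply/asboolP.
  by exists (fun=> 0); rewrite big1 // => t _; rewrite mulr0z.
exists (fun t => a t - b t); rewrite -sumrB.
by apply: eq_bigr => t _; rewrite mulrzBr.
Qed.
HB.instance Definition _ :=
  GRing.isZmodClosed.Build perm_module specht_pred specht_zmod_closed.

Record specht_type :=
  MkSpecht { specht_val :> perm_module; _ : specht_val \in specht_pred }.
HB.instance Definition _ := [isSub for specht_val].
HB.instance Definition _ := [Choice of specht_type by <:].
HB.instance Definition _ := [SubChoice_isSubZmodule of specht_type by <:].

Lemma tableau_actM (s u : 'S_n) (t : tableau) :
  tableau_act (s * u)%g t = tableau_act s (tableau_act u t).
Proof. by apply/val_inj/ffunP => k; rewrite !ffunE permM. Qed.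

Lemma tableau_act1 (t : tableau) : tableau_act 1%g t = t.
Proof. by apply/val_inj/ffunP => k; rewrite !ffunE perm1. Qed.

Lemma tabloid_actM (s u : 'S_n) (T : tabloid) :
  tabloid_act (s * u)%g T = tabloid_act s (tabloid_act u T).
Proof. by apply/val_inj/ffunP => k; rewrite !ffunE permM. Qed.

Lemma tabloid_act1 (T : tabloid) : tabloid_act 1%g T = T.
Proof. by apply/val_inj/ffunP => k; rewrite !ffunE perm1. Qed.

Lemma tabloid_of_act (s : 'S_n) (t : tableau) :
  tabloid_of (tableau_act s t) = tabloid_act s (tabloid_of t).
Proof. by apply/val_inj/ffunP => k; rewrite !ffunE. Qed.

Lemma perm_module_actB (s : 'S_n) : {morph perm_module_act s : u v / u - v}.
Proof. by move=> u v; apply/ffunP => T; rewrite !ffunE. Qed.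
HB.instance Definition _ (s : 'S_n) :=
  GRing.isZmodMorphism.Build perm_module perm_module (perm_module_act s)
    (perm_module_actB s).

Lemma perm_module_act_vec (s : 'S_n) (T : tabloid) :
  perm_module_act s (tabloid_vec T) = tabloid_vec (tabloid_act s T).
Proof.
apply/ffunP => T'; rewrite !ffunE; congr (nat_of_bool _)%:R.
apply/eqP/eqP => [<-|->]; first by rewrite -tabloid_actM mulgV tabloid_act1.
by rewrite -tabloid_actM mulVg tabloid_act1.
Qed.

Lemma perm_module_act_polytabloid (s : 'S_n) (t : tableau) :
  perm_module_act s (polytabloid t) = polytabloid (tableau_act s t).
Proof.
rewrite /polytabloid raddf_sum /= (reindex_inj (@conjg_inj _ s)) /=.
apply: eq_big => [u|u _].
  rewrite !inE; apply/forallP/forallP => H k.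
    have := H (s k); rewrite !ffunE /conjg !permM permK.
    by [].
  have := H (s^-1 k)%g; rewrite !ffunE /conjg !permM permKV.
  by [].
rewrite raddfMz /= perm_module_act_vec -tabloid_of_act -!tableau_actM.
by rewrite odd_permJ /conjg !mulgA mulgV mul1g.
Qed.

Lemma specht_act_subproof (s : 'S_n) (v : specht_type) :
  perm_module_act s (val v) \in specht_pred.
Proof.
have /asboolP[a ->] := valP v; apply/asboolP.
exists (fun t => a (tableau_act s^-1 t)).
rewrite raddf_sum [RHS](reindex (tableau_act s)) /=; last first.
  exists (tableau_act s^-1) => t _; rewrite -tableau_actM ?mulgV ?mulVg;
  exact: tableau_act1.
apply: eq_bigr => t _.
by rewrite raddfMz /= perm_module_act_polytabloid -tableau_actM mulVg tableau_act1.
Qed.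
Definition specht_act (s : 'S_n) (v : specht_type) : specht_type :=
  MkSpecht (specht_act_subproof s v).

Lemma specht_actD s u v : specht_act s (u + v) = specht_act s u + specht_act s v.
Proof. by apply/val_inj; rewrite /= !raddfD. Qed.

Lemma specht_act1 v : specht_act 1%g v = v.
Proof.
by apply/val_inj/ffunP => T; rewrite ffunE /= invg1 tabloid_act1.
Qed.

Lemma specht_actM s u v :
  specht_act (s * u)%g v = specht_act s (specht_act u v).
Proof.
by apply/val_inj/ffunP => T; rewrite !ffunE invMg tabloid_actM.
Qed.

Definition specht : gmodule 'S_n :=
  GModule specht_actD specht_act1 specht_actM.

End Specht.

(** * The graph of partitions whose second cohomology has p-torsion *)

Definition C2 (p : nat) (lam : seq nat) : Prop :=
  is_partition lam /\ dvd_order p (H2 (specht lam)).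

Definition C2_arrow (p : nat) (lam mu : seq nat) : Prop :=
  [/\ C2 p lam, C2 p mu & exists i : nat, mu = incr_nth lam i].

Definition C2_path (p : nat) (P : nat -> seq nat) : Prop :=
  [/\ injective P,
      forall i, C2_arrow p (P i) (P i.+1) &
      forall lam, ~ C2_arrow p lam (P 0%N)].

(* Main.v *)
From HB Require Import structures.
From mathcomp Require Import boolp classical_sets cardinality.
From mathcomp Require Import all_boot all_order all_fingroup all_algebra.
From mathcomp Require Import pgroup.
From mathcomp Require Import generic_quotient ring_quotient zify ring.
Require Import Defs.

Set Implicit Arguments.
Unset Strict Implicit.
Unset Printing Implicit Defensive.

Import GRing.Theory.
Local Open Scope ring_scope.

(** Write S^lam for the integral Specht lattice of a partition lam of n.  Two
    facts determine the p-torsion of H^2(Sigma_n, S^lam) where it is needed.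

    The sum of all transpositions is central in the group ring.  On S^lam it is
    multiplication by the sum of the contents of lam, and on the cohomology of
    any module it agrees with multiplication by the number of transpositions
    [class_sum_scalar]; hence the difference of these two integers annihilates
    H^2 [specht_content_torsion].  Up to sign it is b (a + 1) for (a, b) and
    (a + 2) (b + 1) for (a, b, 1), so that (mp + s, p + 1) with s <= p - 2 and
    (mp + s, p, 1) with s < p - 2 carry no p-torsion.

    For lam = (a, p), let M^k be the permutation lattice on the k-subsets of the
    n = a + p letters, and theta : M^p -> M^(p-1) the map sending a set to the
    sum of its subsets with one element less.  Then S^lam is the kernel of theta
    [two_row_kernel], and p-locally the cokernel of theta is Z/p, detected by
    the sum of coefficients [reach_of_sum, sum_down].  A transitive permutation
    lattice has no H^1, and H^2 of M^p has no p-torsion, because the stabiliser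
    of a set is generated by transpositions and p is odd.  Two connecting maps
    therefore identify the p-torsion of H^2(Sigma_n, S^lam) with the cokernel of
    the sum of coefficients from the invariants of M^(p-1) to Z/p
    [connecting_prank1, connecting_torsion_free].  The invariants are spanned by
    the sum of all (p-1)-subsets, with 'C(n, p - 1) terms; for a = mp + s with
    s < p this number is divisible by p exactly when s <= p - 2.  So the p-rank
    is 1 for s <= p - 2, and there is no p-torsion for s = p - 1.

    A successor of (mp + s, p) is (mp + s + 1, p), (mp + s, p + 1) or
    (mp + s, p, 1); the two facts leave the first one for s < p - 2 and the last
    one for s = p - 2. *)

(** * Linear identities in abelian groups *)

Section AbelianIdentities.

Inductive zexpr := ZVar of nat | ZAdd of zexpr & zexpr | ZOpp of zexpr | ZZero.

Fixpoint zeval (V : zmodType) (env : seq V) (e : zexpr) : V :=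
  match e with
  | ZVar i => env`_i
  | ZAdd e1 e2 => zeval env e1 + zeval env e2
  | ZOpp e1 => - zeval env e1
  | ZZero => 0
  end.

Fixpoint zcoef (e : zexpr) (i : nat) : int :=
  match e with
  | ZVar j => if i == j then 1 else 0
  | ZAdd e1 e2 => zcoef e1 i + zcoef e2 i
  | ZOpp e1 => - zcoef e1 i
  | ZZero => 0
  end.

Lemma zevalE (V : zmodType) (env : seq V) (e : zexpr) :
  zeval env e = \sum_(i < size env) env`_i *~ zcoef e i.
Proof.
elim: e => [j|e1 IH1 e2 IH2|e1 IH1|] /=.
- have [lt_j|le_j] := ltnP j (size env).
    rewrite (bigD1 (Ordinal lt_j)) //= eqxx mulr1z big1 ?addr0 // => i.
    by rewrite -val_eqE /= => /negbTE->; rewrite mulr0z.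
  rewrite nth_default // big1 // => i _.
  by rewrite ltn_eqF ?mulr0z // (leq_trans (ltn_ord i)).
- by rewrite IH1 IH2 -big_split; apply: eq_bigr => i _; rewrite mulrzDr.
- by rewrite IH1 -sumrN; apply: eq_bigr => i _; rewrite mulrNz.
- by rewrite big1 // => i _; rewrite mulr0z.
Qed.

Lemma zeval_eq (V : zmodType) (env : seq V) (e1 e2 : zexpr) :
  all (fun i => zcoef e1 i == zcoef e2 i) (iota 0 (size env)) ->
  zeval env e1 = zeval env e2.
Proof.
move=> /allP E; rewrite !zevalE; apply: eq_bigr => i _; congr (_ *~ _).
by apply/eqP/E; rewrite mem_iota add0n ltn_ord.
Qed.

End AbelianIdentities.

(* Atoms are compared up to conversion, since the same subterm may be elaborated
   through different instances. *)
Ltac zindex x env :=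
  lazymatch env with
  | cons ?y ?t =>
    match constr:(tt) with
    | _ => let _ := constr:(erefl x : x = y) in constr:(0%N)
    | _ => let i := zindex x t in constr:(S i)
    end
  end.
Ltac zinsert x env :=
  match constr:(tt) with
  | _ => let _ := zindex x env in env
  | _ => constr:(cons x env)
  end.
Ltac zatoms t env :=
  lazymatch t with
  | GRing.add ?a ?b => let e := zatoms a env in zatoms b e
  | GRing.opp ?a => zatoms a env
  | GRing.zero => env
  | _ => zinsert t env
  end.
Ltac zreify t env :=
  lazymatch t with
  | GRing.add ?a ?b =>
      let x := zreify a env in let y := zreify b env in constr:(ZAdd x y)
  | GRing.opp ?a => let x := zreify a env in constr:(ZOpp x)
  | GRing.zero => constr:(ZZero)
  | _ => let i := zindex t env in constr:(ZVar i)
  end.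

(** Cocycle computations take place in an arbitrary module, where such an
    identity holds as soon as each atom has the same multiplicity on both
    sides. *)
Ltac abelian :=
  lazymatch goal with
  | |- @eq ?T ?a ?b =>
    let env0 := constr:(@nil T) in
    let env1 := zatoms a env0 in
    let env := zatoms b env1 in
    let x := zreify a env in
    let y := zreify b env in
    apply: (@zeval_eq _ env x y); vm_compute; reflexivity
  end.

(** * Degree-two classes and class sums *)

Section DegreeTwoClasses.
Local Open Scope quotient_scope.
Variables (gT : finGroupType) (M : gmodule gT).

Definition cochain (c : Z2 M) (g h : gT) : M := Z2val c (g, h).

Definition cohomology_class (c : Z2 M) : H2 M := \pi_(H2 M) c.

Lemma cohomology_class_is_zmod_morphism : zmod_morphism cohomology_class.
Proof. by move=> c d; rewrite /cohomology_class !piE. Qed.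
HB.instance Definition _ := GRing.isZmodMorphism.Build (Z2 M) (H2 M)
  cohomology_class cohomology_class_is_zmod_morphism.

Lemma cohomology_classMn (c : Z2 M) (k : nat) :
  cohomology_class (c *+ k) = cohomology_class c *+ k.
Proof. exact: raddfMn. Qed.

Lemma cohomology_classB (c d : Z2 M) :
  cohomology_class (c - d) = cohomology_class c - cohomology_class d.
Proof. exact: raddfB. Qed.

Lemma cohomology_class_surj (x : H2 M) : exists c, x = cohomology_class c.
Proof. by exists (repr x); rewrite /cohomology_class reprK. Qed.

Lemma cohomology_class_eq0 (c : Z2 M) :
  cohomology_class c = 0 <->
  exists b : gT -> M, forall g h,
    cochain c g h = gact g (b h) - b (g * h)%g + b g.
Proof.
have -> : cohomology_class c = 0 <-> c \in coboundary2 (M := M).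
  rewrite -[c in X in _ <-> X]subr0 Quotient.idealrBE /cohomology_class.
  rewrite -(raddf0 cohomology_class); split=> [->|/eqP->] //.
split=> [/asboolP[b bP]|[b bP]]; first by exists b.
by apply/asboolP; exists (finfun b) => g h; rewrite !ffunE; exact: bP.
Qed.

Lemma cocycle2E (c : Z2 M) (g h k : gT) :
  gact g (cochain c h k) =
    cochain c (g * h)%g k - cochain c g (h * k)%g + cochain c g h.
Proof.
have /asboolP/(_ g h k) := Z2valP c.
rewrite -!/(cochain c _ _) => E.
have <- : gact g (cochain c h k) - (gact g (cochain c h k)
   - cochain c (g * h)%g k + cochain c g (h * k)%g - cochain c g h)
   = cochain c (g * h)%g k - cochain c g (h * k)%g + cochain c g h.
  by abelian.
by rewrite E subr0.
Qed.

(** The converse of cocycle2E, as a constructor of cocycles. *)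
Lemma cocycle2_of_fun (f : gT -> gT -> M) :
    (forall g h k : gT,
       gact g (f h k) = f (g * h)%g k - f g (h * k)%g + f g h) ->
  exists c : Z2 M, forall g h, cochain c g h = f g h.
Proof.
move=> fP; pose c : cochain2 M := [ffun x => f x.1 x.2].
suff cP : c \in @cocycle2 gT M.
  by exists (MkZ2 cP) => g h; rewrite /cochain /= ffunE.
apply/asboolP => g h k; rewrite !ffunE /= fP.
set a := f (g * h)%g k; set b := f g (h * k)%g; set d := f g h; abelian.
Qed.

Lemma cochainD (c d : Z2 M) g h :
  cochain (c + d) g h = cochain c g h + cochain d g h.
Proof. by rewrite /cochain -[Z2val (c + d)]/(val (c + d)) raddfD ffunE. Qed.

Lemma cochainMn (c : Z2 M) (k : nat) g h :
  cochain (c *+ k) g h = cochain c g h *+ k.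
Proof.
elim: k => [|k IH]; first by rewrite !mulr0n /cochain -[Z2val 0]/(val 0) raddf0
  ffunE.
by rewrite !mulrS cochainD IH.
Qed.

Lemma cochainN (c : Z2 M) g h : cochain (- c) g h = - cochain c g h.
Proof. by rewrite /cochain -[Z2val (- c)]/(val (- c)) raddfN ffunE. Qed.

Lemma cochainMz (c : Z2 M) (k : int) g h :
  cochain (c *~ k) g h = cochain c g h *~ k.
Proof.
by case: k => k; rewrite ?NegzE ?mulrNz -!pmulrn ?cochainN cochainMn.
Qed.

(** Central elements act in the same way through the coefficients and through
    the trivial module.  Explicitly, the cocycle identity expresses tau c(g, h)
    by values of c with tau in one slot; summing over the family, tau g =
    g (tau ^ g) moves tau from the first slot to the last, and what remains is
    c(g, h) for each tau and the coboundary of the sum of c(tau, g) - c(g, tau)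
    over tau. *)
Lemma class_sum_scalar (I : finType) (x : I -> gT) (conj : gT -> I -> I)
    (z : int) :
    (forall g, injective (conj g)) ->
    (forall g i, x (conj g i) = (x i ^ g)%g) ->
    (forall v : M, \sum_i gact (x i) v = v *~ z) ->
  forall u : H2 M, u *~ (z - #|I|%:Z) = 0.
Proof.
move=> conj_inj conjE zP u; have [c ->] := cohomology_class_surj u.
have gactS g (F : I -> M) : gact g (\sum_i F i) = \sum_i gact g (F i).
  by elim/big_rec2: _ => [|i a b _ <-]; rewrite ?gact0 ?gactD.
have xg g i : (x i * g = g * x (conj g i))%g.
  by rewrite conjE conjgE mulgA mulgV mul1g.
have shift g (F : gT -> M) : \sum_i F (x (conj g i)) = \sum_i F (x i).
  by rewrite [RHS](reindex_inj (conj_inj g)).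
rewrite -raddfMz; apply/cohomology_class_eq0.
pose b g : M := \sum_i (cochain c (x i) g - cochain c g (x i)).
exists b => g h.
have -> : cochain (c *~ (z - #|I|%:Z)) g h
    = cochain c g h *~ z - \sum_(i : I) cochain c g h.
  by rewrite cochainMz sumr_const pmulrn mulrzBr.
rewrite -zP.
have -> : \sum_i gact (x i) (cochain c g h) =
  \sum_i (cochain c (x i * g)%g h - cochain c (x i) (g * h)%g + cochain c (x i)
    g).
  by apply: eq_bigr => i _; rewrite cocycle2E.
have E1 : \sum_i cochain c (x i * g)%g h =
   \sum_i (gact g (cochain c (x i) h) + cochain c g (x i * h)%g - cochain c g
     (x i)).
  rewrite (eq_bigr (fun i => cochain c (g * x (conj g i))%g h)); last first.
    by move=> i _; rewrite xg.
  rewrite (shift g (fun y => cochain c (g * y)%g h)).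
  apply: eq_bigr => i _; rewrite cocycle2E.
  by set a1 := cochain c _ _; set a2 := cochain c _ _; set a3 := cochain c _ _;
     abelian.
have E2 : \sum_i cochain c g (x i * h)%g =
   \sum_i (cochain c g h + cochain c (g * h)%g (x i) - gact g (cochain c h (x
     i))).
  rewrite (eq_bigr (fun i => cochain c g (h * x (conj h i))%g)); last first.
    by move=> i _; rewrite xg.
  rewrite (shift h (fun y => cochain c g (h * y)%g)).
  apply: eq_bigr => i _; rewrite cocycle2E.
  by set a1 := cochain c _ _; set a2 := cochain c _ _; set a3 := cochain c _ _;
     abelian.
rewrite /b gactS; under [in RHS]eq_bigr do rewrite gactB.
move: E1; rewrite !big_split /= E2 !big_split !sumrN /= => ->.
abelian.
Qed.

Lemma gactMn (g : gT) (v : M) (k : nat) : gact g (v *+ k) = gact g v *+ k.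
Proof.
elim: k => [|k IH]; first by rewrite !mulr0n gact0.
by rewrite !mulrS gactD IH.
Qed.

Lemma gactMz (g : gT) (v : M) (k : int) : gact g (v *~ k) = gact g v *~ k.
Proof.
case: k => k; first by rewrite -!pmulrn gactMn.
rewrite NegzE !mulrNz -!pmulrn -gactMn -[- (v *+ _)]sub0r gactB gact0.
exact: sub0r.
Qed.

End DegreeTwoClasses.

(** * Torsion in finite abelian groups *)

Section TransportedGroup.
Variables (A : zmodType) (k : nat) (f : A -> 'I_k) (g : 'I_k -> A).
Hypotheses (fK : cancel f g) (gK : cancel g f).

(** The group A carried over to the finite type 'I_k, where Cauchy's theorem
    provides an element of order p. *)
Definition transported : Type := 'I_k.
HB.instance Definition _ := Finite.on transported.

Let add (x y : transported) : transported := f (g x + g y).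
Let opp (x : transported) : transported := f (- g x).
Let addA : associative add.
Proof. by move=> x y z; rewrite /add !fK addrA. Qed.
Let addC : commutative add.
Proof. by move=> x y; rewrite /add addrC. Qed.
Let add0 : left_id (f 0 : transported) add.
Proof. by move=> x; rewrite /add fK add0r gK. Qed.
Let addN : left_inverse (f 0 : transported) opp add.
Proof. by move=> x; rewrite /add /opp fK addNr. Qed.
HB.instance Definition _ := GRing.isZmodule.Build transported addA addC add0
  addN.
HB.instance Definition _ := [finGroupMixin of transported for +%R].

Lemma transportedK (x : transported) (n : nat) : g (x *+ n) = g x *+ n.
Proof.
elim: n => [|n IH]; first by rewrite !mulr0n fK.
by rewrite !mulrS fK IH.
Qed.

Lemma zmod_cauchy_transported (p : nat) :
  prime p -> (p %| k)%N -> exists2 x : A, x != 0 & x *+ p = 0.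
Proof.
move=> p_pr pk; have : (p %| #|[set: transported]|)%N by rewrite cardsT
  card_ord.
case/(Cauchy p_pr) => x _ ox; exists (g x).
  apply/eqP => gx0; have : x = 1%g by rewrite -[x]gK gx0.
  by move=> x1; move: ox p_pr; rewrite x1 order1 => <-.
rewrite -transportedK -[x *+ p]/(x ^+ p)%g -ox expg_order; exact: fK.
Qed.
End TransportedGroup.

Lemma dvd_order_torsion (A : zmodType) (p : nat) :
  prime p -> dvd_order p A -> exists2 x : A, x != 0%R & (x *+ p = 0)%R.
Proof.
move=> p_pr [k [/card_set_bijP[f [f_fun f_inj f_surj]] pk]].
have f_lt x : (f x < k)%N by exact: f_fun.
have /choice[g gP] (i : 'I_k) : exists x, f x = i.
  by have [x _ fx] := f_surj i (ltn_ord i); exists x.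
apply: (@zmod_cauchy_transported A k (fun x => Ordinal (f_lt x)) g) => //.
  by move=> x; apply: f_inj; rewrite ?classical_sets.in_setT // gP.
by move=> i; apply/val_inj; rewrite /= gP.
Qed.

Lemma coprime_torsion (A : zmodType) (a b : nat) (u : A) :
  coprime a b -> (0 < a)%N -> u *+ a = 0 -> u *+ b = 0 -> u = 0.
Proof.
move=> ab a_gt0 ua ub; case: (egcdnP b a_gt0) => ka kb Eab _.
have : u *+ (ka * a) = u *+ (kb * b + 1) by rewrite Eab (eqP ab).
by rewrite mulrnDr !(mulnC _ a, mulnC _ b) !mulrnA ua ub !mul0rn add0r mulr1n.
Qed.

Section CyclicTorsion.
Variables (p : nat) (p_pr : prime p) (A : zmodType) (u : A).
Hypotheses (pu : u *+ p = 0) (u_free : forall k : nat, u *+ k = 0 -> (p %| k)%N)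
  (u_gen : forall x, x *+ p = 0 -> exists k : nat, x = u *+ k).

Definition multiple_of_row (v : 'rV['F_p]_1) : A := u *+ (v 0 0 : nat).

Let mod_p (k : nat) : u *+ (k %% (Zp_trunc (pdiv p)).+2) = u *+ k.
Proof.
rewrite (Fp_cast p_pr).
by rewrite {2}(divn_eq k p) mulrnDr mulnC mulrnA pu mul0rn add0r.
Qed.

Lemma multiple_of_row_is_nmod_morphism : nmod_morphism multiple_of_row.
Proof.
split=> [|v w]; rewrite /multiple_of_row !mxE ?mulr0n //.
by rewrite -mulrnDr /= -[in RHS]mod_p.
Qed.
HB.instance Definition _ := GRing.isNmodMorphism.Build 'rV['F_p]_1 A
  multiple_of_row multiple_of_row_is_nmod_morphism.

Lemma cyclic_torsion_prank1 : has_prank p A 1.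
Proof.
exists (fun x : A => x *+ p == 0); last first.
  exists multiple_of_row.
    apply/raddf_inj => v; rewrite /multiple_of_row => /u_free pv.
    apply/rowP => i; rewrite !ord1 mxE; apply/val_inj => /=; apply/eqP.
    have : (v 0%R 0%R < p)%N by apply: leq_trans (ltn_ord _) _; rewrite Fp_cast.
    apply: contraTT; rewrite -lt0n -leqNgt => v_gt0; exact: dvdn_leq v_gt0 pv.
  move=> x; split=> [/eqP/u_gen[k ->]|[v <-]].
    exists (const_mx k%:R); rewrite /= /multiple_of_row mxE -(mod_p k).
    by rewrite val_Fp_nat // Fp_cast.
  by rewrite unfold_in /= /multiple_of_row mulrnAC pu mul0rn.
split=> [|F [_ pF] EF x].
  split=> [|x /eqP]; last by [].
  split=> [|x y]; rewrite !unfold_in ?mul0rn // => /eqP px /eqP py.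
  by rewrite mulrnBl px py subrr.
by apply/idP/idP => [/pF|/EF] // px; rewrite unfold_in px.
Qed.

End CyclicTorsion.

Definition H1_trivial (gT : finGroupType) (M : gmodule gT) : Prop :=
  forall b : gT -> M, (forall g h : gT, b (g * h)%g = gact g (b h) + b g) ->
  exists x : M, forall g, b g = gact g x - x.

Definition H2_torsion_free (p : nat) (gT : finGroupType) (M : gmodule gT) :
  Prop :=
  forall u : H2 M, u *+ p = 0 -> u = 0.

(** * Connecting maps for a kernel of permutation lattices *)

Section LatticeSequence.
Variables (gT : finGroupType) (S M1 M2 : gmodule gT).
Variables (iota : {additive S -> M1}) (theta : {additive M1 -> M2})
  (aug : {additive M2 -> int}).
Hypotheses (iota_inj : injective iota)
  (iota_act : forall g x, iota (gact g x) = gact g (iota x))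
  (theta_act : forall g x, theta (gact g x) = gact g (theta x))
  (theta_iota : forall x, theta (iota x) = 0)
  (theta_ker : forall y, theta y = 0 -> exists x, iota x = y)
  (aug_act : forall g y, aug (gact g y) = aug y).
Variables (p N : nat) (p_pr : prime p) (pN : coprime p N).
Hypotheses (aug_theta : forall x, (p %| aug (theta x))%Z)
  (theta_im : forall y, (p %| aug y)%Z -> exists x, theta x = y *+ N).
Hypotheses (H1M1 : H1_trivial M1) (H1M2 : H1_trivial M2)
  (H2M1 : H2_torsion_free p M1).

(** For b as here, c is the image of the class of y under the connecting maps of
    0 -> S -> M1 -> theta M1 -> 0 and 0 -> theta M1 -> M2 -> M2 / theta M1 -> 0. *)
Definition connects (c : Z2 S) (b : gT -> M1) (y : M2) : Prop :=
  (forall g h, iota (cochain c g h) = gact g (b h) - b (g * h)%g + b g) /\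
  (forall g, theta (b g) = gact g y - y).

Lemma connectsB c b y d b' y' : connects c b y -> connects d b' y' ->
  connects (c - d) (fun g => b g - b' g) (y - y').
Proof.
move=> [cb byP] [db' by'P]; split=> [g h|g].
  rewrite cochainD cochainN raddfB /= cb db' gactB; abelian.
rewrite raddfB /= byP by'P gactB; abelian.
Qed.

Lemma connectsMn c b y (k : nat) : connects c b y ->
  connects (c *+ k) (fun g => b g *+ k) (y *+ k).
Proof.
move=> [cb byP]; split=> [g h|g].
  by rewrite cochainMn raddfMn /= cb gactMn mulrnDl mulrnBl.
by rewrite raddfMn /= byP gactMn mulrnBl.
Qed.

Lemma connects_shift c b y z : connects c b y -> (forall g, gact g z = z) ->
  connects c b (y - z).
Proof.
move=> [cb byP] zP; split=> // g; rewrite byP gactB zP; abelian.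
Qed.

(** gact g y - y has augmentation 0, so that N times it is in the image of
    theta; a choice of preimages is b, and its coboundary is S-valued. *)
Lemma connects_exists y : exists c b, connects c b ((y : M2) *+ N).
Proof.
have /choice[b bP] (g : gT) : exists x, theta x = (gact g y - y) *+ N.
  by apply: theta_im; rewrite raddfB /= aug_act subrr dvdz0.
pose db (x : gT * gT) := gact x.1 (b x.2) - b (x.1 * x.2)%g + b x.1.
have /choice[s sP] (x : gT * gT) : exists t, iota t = db x.
  apply: theta_ker; rewrite /db raddfD raddfB /= theta_act !bP gactMn gactB.
  by rewrite -mulrnBl -mulrnDl -gactM -[RHS](mul0rn _ N); congr (_ *+ _);
    abelian.
have [|c cP] := @cocycle2_of_fun gT S (fun g h => s (g, h)).
  move=> g h k; apply: iota_inj; rewrite iota_act raddfD raddfB /= !sP /db /=.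
  by rewrite !(gactB, gactD) -gactM mulgA; abelian.
exists c, b; split=> [g h|g]; first by rewrite cP sP.
by rewrite bP mulrnBl gactMn.
Qed.

(** c becomes the coboundary of some b over M1, since it is p-torsion there;
    theta b is then a 1-cocycle of M2, hence the coboundary of some y. *)
Lemma connects_torsion c :
  cohomology_class c *+ p = 0 -> exists b y, connects c b y.
Proof.
move=> pc.
have [|d dP] := @cocycle2_of_fun gT M1 (fun g h => iota (cochain c g h)).
  by move=> g h k; rewrite -iota_act cocycle2E raddfD raddfB.
have pd : cohomology_class d *+ p = 0.
  rewrite -cohomology_classMn; apply/cohomology_class_eq0.
  move: pc; rewrite -cohomology_classMn => /cohomology_class_eq0[s sP].
  exists (fun g => iota (s g)) => g h.
  rewrite cochainMn dP -raddfMn -cochainMn sP raddfD raddfB.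
  by rewrite iota_act.
have /cohomology_class_eq0[b bP] := H2M1 pd.
have [|y yP] := H1M2 (b := fun g => theta (b g)).
  move=> g h; have := theta_iota (cochain c g h).
  rewrite -dP bP raddfD raddfB /= theta_act => E.
  by rewrite -[LHS]addr0 -E; abelian.
by exists b, y; split=> // g h; rewrite -dP bP.
Qed.

(** If N y = theta x, subtracting the coboundary of x makes N b take its values
    in S. *)
Lemma connects_eq0 c b y :
  connects c b y -> (p %| aug y)%Z -> cohomology_class c *+ N = 0.
Proof.
move=> /(connectsMn N)[cb byP] /theta_im[x xP].
have /choice[s sP] (g : gT) : exists t, iota t = b g *+ N - (gact g x - x).
  by apply: theta_ker; rewrite !raddfB /= byP theta_act xP; abelian.
rewrite -cohomology_classMn; apply/cohomology_class_eq0; exists s => g h.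
apply: iota_inj; rewrite cb raddfD raddfB iota_act !sP !gactB -gactM.
abelian.
Qed.

(** If c is the coboundary of s, then b - s is a 1-cocycle of M1, hence the
    coboundary of some x, and y - theta x is invariant. *)
Lemma connects_trivial c b y : connects c b y -> cohomology_class c = 0 ->
  exists x z, (forall g, gact g z = z) /\ y = theta x + z.
Proof.
move=> [cb byP] /cohomology_class_eq0[s sP].
have [|x xP] := H1M1 (b := fun g => b g - iota (s g)).
  move=> g h; have := cb g h; rewrite sP raddfD raddfB iota_act gactB => E.
  have -> : b (g * h)%g = b (g * h)%g + (gact g (b h) - b (g * h)%g + b g)
     - (gact g (iota (s h)) - iota (s (g * h)%g) + iota (s g)).
    by rewrite -E addrK.
  by abelian.
exists x, (y - theta x); split=> [g|]; last by rewrite addrC subrK.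
have := byP g; have /(congr1 theta) := xP g.
rewrite !raddfB /= theta_iota theta_act subr0 gactB => -> E.
have -> : gact g y = gact g y - y + y by abelian.
by rewrite -E; abelian.
Qed.

Let p_gt0 : (0 < p)%N := prime_gt0 p_pr.

Lemma connects_unique c b y : connects c b y -> cohomology_class c *+ p = 0 ->
  (p %| aug y)%Z -> cohomology_class c = 0.
Proof. by move=> cby pc /(connects_eq0 cby); apply: coprime_torsion pN _ _. Qed.

(** The invariant z corrects the augmentation of any y to a multiple of p. *)
Lemma connecting_torsion_free (z : M2) :
    (forall g, gact g z = z) -> ~~ (p %| aug z)%Z ->
  H2_torsion_free p S.
Proof.
move=> zP pz u; have [c ->] := cohomology_class_surj u => pc.
have [b [y cby]] := connects_torsion pc.
have [k yk] : exists k : int, (p %| aug (y - z *~ k))%Z.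
  have pz1 : coprimez p (aug z) by rewrite coprimezE /= prime_coprime.
  have [[v w] vw] := coprimezP _ _ pz1.
  exists (w * aug y); rewrite raddfB raddfMz /=.
  apply/dvdzP; exists (v * aug y); rewrite -mulrzr intz.
  by rewrite -{1}[aug y]mulr1 -vw /=; ring.
apply: connects_unique yk => //; apply: connects_shift cby _ => g.
by rewrite gactMz zP.
Qed.

(** The torsion is generated by the class of N ^ 2 y0: one factor N is needed to
    lift the coboundary of y0 through theta, and the other one to kill p times
    the resulting class. *)
Lemma connecting_prank1 (y0 : M2) :
    aug y0 = 1 -> (forall z, (forall g, gact g z = z) -> (p %| aug z)%Z) ->
  has_prank p (H2 S) 1.
Proof.
move=> y0P invP; have [c [b cby]] := connects_exists y0.
pose u := cohomology_class c *+ N.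
have dP := connectsMn N cby.
have augMn y k : aug (y *+ k) = aug y * k%:Z by rewrite raddfMn -mulr_natr natz.
have pu : u *+ p = 0.
  rewrite /u mulrnAC -cohomology_classMn.
  apply: connects_eq0 (connectsMn p cby) _.
  by rewrite augMn dvdz_mull.
apply: (cyclic_torsion_prank1 p_pr pu) => [k|x].
  rewrite /u -!cohomology_classMn => uk0.
  have [x [z [zP E]]] := connects_trivial (connectsMn k dP) uk0.
  have : (p %| aug (y0 *+ N *+ N *+ k))%Z by rewrite E raddfD rpredD ?aug_theta
    ?invP.
  rewrite !augMn y0P mul1r -!PoszM.
  by rewrite dvdzE /= mulnC Gauss_dvdl // coprimeMr pN.
have [e ->] := cohomology_class_surj x => pe.
have [b' [y eb'y]] := connects_torsion pe.
have [k yk] : exists k : nat, (p %| aug (y - y0 *+ N *+ N *+ k))%Z.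
  have pNN : coprimez p (N * N)%N by rewrite coprimezE /= coprimeMr pN.
  have [[v w] vw] := coprimezP _ _ pNN.
  exists `|(w * aug y %% p)%Z|%N.
  rewrite raddfB !augMn y0P mul1r gez0_abs ?modz_ge0 //; last by case: p p_gt0.
  have := divz_eq (w * aug y) p; move: vw => /=.
  set r := (_ %% _)%Z; set q := (_ %/ _)%Z => vw rq.
  apply/dvdzP; exists (v * aug y + q * (N * N)%N).
  have -> : r = w * aug y - q * p by rewrite rq addrC addrA addNr add0r.
  by rewrite -{1}[aug y]mulr1 -vw PoszM; ring.
exists k; apply/eqP; rewrite -subr_eq0 /u -!cohomology_classMn
  -cohomology_classB; apply/eqP.
apply: (connects_unique (connectsB eb'y (connectsMn k dP)) _ yk).
rewrite cohomology_classB !cohomology_classMn mulrnBl pe -/u mulrnAC.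
by rewrite pu mul0rn subr0.
Qed.

End LatticeSequence.

(** * Cohomology of transitive permutation modules *)

Lemma dvdz_eqD (d a b c : int) :
  (d %| b)%Z -> (d %| c)%Z -> a = b + c -> (d %| a)%Z.
Proof. by move=> db dc ->; apply: rpredD. Qed.

Lemma dvdz_eqB (d a b c : int) :
  (d %| b)%Z -> (d %| c)%Z -> a = b - c -> (d %| a)%Z.
Proof. by move=> db dc ->; apply: rpredB. Qed.

Section PermutationModule.
Variables (gT : finGroupType) (W : finType) (act : gT -> W -> W).
Hypotheses (act1 : forall w, act 1%g w = w)
  (actM : forall (g h : gT) w, act (g * h)%g w = act g (act h w)).

Definition permute (g : gT) (f : {ffun W -> int}) : {ffun W -> int} :=
  [ffun w => f (act g^-1%g w)].

Lemma permuteD g f f' : permute g (f + f') = permute g f + permute g f'.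
Proof. by apply/ffunP => w; rewrite !ffunE. Qed.

Lemma permute1 f : permute 1%g f = f.
Proof. by apply/ffunP => w; rewrite !ffunE invg1 act1. Qed.

Lemma permuteM (g h : gT) f : permute (g * h)%g f = permute g (permute h f).
Proof. by apply/ffunP => w; rewrite !ffunE invMg actM. Qed.

Definition permutation_gmodule : gmodule gT := GModule permuteD permute1
  permuteM.

Variable w0 : W.
Hypothesis act_trans : forall w, exists g, act g w0 = w.

(** Averaging b over the group shows that |G| b is a coboundary of some B.  As B
    is invariant modulo |G| and the action is transitive, B is constant modulo
    |G|, so that B can be divided by |G| up to a constant. *)
Lemma permutation_H1_trivial : H1_trivial permutation_gmodule.
Proof.
move=> b bP; pose n : int := #|gT|%:Z.
have n_neq0 : n != 0 by rewrite eqz_nat -lt0n; apply/card_gt0P; exists 1%g.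
pose B : {ffun W -> int} := \sum_(h : gT) b h.
have BE g w : B w - B (act g^-1%g w) = b g w * n.
  rewrite {1}/B (reindex_inj (mulgI g)) /= (eq_bigr _ (fun h _ => bP g h)).
  rewrite big_split sumr_const ffunE /= ffunMnE -mulr_natr natz.
  suff -> : (\sum_(h : gT) permute g (b h)) w = B (act g^-1%g w).
    by rewrite addrAC subrr add0r.
  by rewrite /B !sum_ffunE; apply: eq_bigr => h _; rewrite ffunE.
have Bdvd w : (n %| B w0 - B w)%Z.
  have [g <-] := act_trans w; rewrite -[g]invgK BE; exact: dvdz_mull.
exists [ffun w => ((B w0 - B w) %/ n)%Z] => g; apply/ffunP => w.
rewrite !ffunE; apply: (mulIf n_neq0).
rewrite mulrBl !divzK // -BE.
by set x := B w; set y := B _; set z := B _; ring.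
Qed.

(** The 1-cocycle condition modulo p makes phi g = b g w0 additive on the
    stabiliser of w0, hence zero there; phi then factors through the orbit map,
    and the induced function on W has coboundary b modulo p. *)
Lemma permutation_H2_torsion_free (p : nat) : (0 < p)%N ->
    (forall phi : gT -> int,
       (forall g h, act g w0 = w0 -> act h w0 = w0 ->
          (p %| phi (g * h)%g - (phi g + phi h))%Z) ->
       forall g, act g w0 = w0 -> (p %| phi g)%Z) ->
  H2_torsion_free p permutation_gmodule.
Proof.
move=> p_gt0 homP u; have [c ->] := cohomology_class_surj u.
have p_neq0 : p%:Z != 0 by rewrite eqz_nat -lt0n.
rewrite -cohomology_classMn => /cohomology_class_eq0[b bP];
  apply/cohomology_class_eq0.
have bE (g h : gT) w : b h (act g^-1%g w) - b (g * h)%g w + b g w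
    = (cochain c g h : {ffun W -> int}) w * p%:Z.
  have /ffunP/(_ w) := bP g h; rewrite cochainMn /= !ffunE ffunMnE => <-.
  by rewrite -mulr_natr natz.
have bdvd (g h : gT) w :
    (p %| b (g * h)%g w - (b h (act g^-1%g w) + b g w))%Z.
  apply/dvdzP; exists (- (cochain c g h : {ffun W -> int}) w).
  by rewrite mulNr -bE; ring.
have fixV g : act g w0 = w0 -> act g^-1%g w0 = w0.
  by move=> gw; rewrite -{1}gw -actM mulVg act1.
pose phi g := b g w0.
have phi0 g : act g w0 = w0 -> (p %| phi g)%Z.
  apply: homP => {}g h gw hw; have := bdvd g h w0.
  by rewrite fixV // [b h _ + _]addrC.
have phi_orbit g h : act g^-1%g w0 = act h^-1%g w0 -> (p %| phi g - phi h)%Z.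
  move=> gh; pose k := (g * h^-1)%g.
  have kw : act k w0 = w0 by rewrite actM -gh -actM mulgV act1.
  have := bdvd k h w0; rewrite fixV // /k mulgKV -/(phi _) -/(phi _) -/(phi _).
  by move=> H; apply: (dvdz_eqD H (phi0 _ kw)); rewrite /k; ring.
have /choice[t tP] (w : W) : exists t, act t^-1%g w0 = w.
  by have [g <-] := act_trans w; exists g^-1%g; rewrite invgK.
pose y (w : W) := phi (t w).
have by_dvd (g : gT) w : (p %| b g w - (y (act g^-1%g w) - y w))%Z.
  have := bdvd (t w) g w0; rewrite tP -/(phi (t w)) -/(y w) -/(phi _).
  have : (p %| phi (t w * g)%g - y (act g^-1%g w))%Z.
    by apply: phi_orbit; rewrite tP invMg actM tP.
  by move=> H1 H2; apply: (dvdz_eqB H1 H2); ring.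
exists (fun g => [ffun w => ((b g w - (y (act g^-1%g w) - y w)) %/ p)%Z]).
move=> g h; apply/ffunP => w; rewrite !ffunE; apply: (mulIf p_neq0).
rewrite -bE mulrDl mulrBl !divzK // invMg actM.
by set x1 := y _; set x2 := y _; set x3 := y _; ring.
Qed.

End PermutationModule.

Lemma preim_tperm (T : finType) (A : {set T}) (x y : T) :
  (x \in A) = (y \in A) -> tperm x y @^-1: A = A.
Proof. by move=> xy; apply/setP => z; rewrite inE; case: tpermP => // ->. Qed.

(** The stabiliser of A is generated by transpositions, and these are killed by
    a homomorphism to a group of odd order. *)
Lemma set_stabiliser_hom_trivial (T : finType) (A : {set T}) (p : nat)
    (phi : {perm T} -> int) :
    prime p -> (2 < p)%N ->
    (forall s u : {perm T}, s @^-1: A = A -> u @^-1: A = A ->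
       (p %| phi (s * u)%g - (phi s + phi u))%Z) ->
  forall s : {perm T}, s @^-1: A = A -> (p %| phi s)%Z.
Proof.
move=> p_pr p_gt2 homP.
have stab1 : (1%g : {perm T}) @^-1: A = A by apply/setP => x; rewrite inE perm1.
have phi1 : (p %| phi 1%g)%Z.
  have := homP _ _ stab1 stab1; rewrite mul1g opprD addrA subrr sub0r.
  by rewrite rpredN.
have phi_tperm x y : (x \in A) = (y \in A) -> (p %| phi (tperm x y))%Z.
  move=> /preim_tperm st; have := homP _ _ st st; rewrite tperm2 => H.
  have : (p %| 2%:Z * phi (tperm x y))%Z.
    by apply: (dvdz_eqB phi1 H); ring.
  by rewrite Gauss_dvdzr // coprimezE /= prime_coprime // gtnNdvd.
move=> s; have [n] := ubnP #|[set x | s x != x]|; elim: n s => // n IH s.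
rewrite ltnS => le_n sA.
have [/existsP[x sx]|/existsPn s_id] := boolP [exists x, s x != x]; last first.
  have -> : s = 1%g by apply/permP => x; rewrite perm1; apply/eqP;
    rewrite -[_ == _]negbK.
  exact: phi1.
have xA : (x \in A) = (s x \in A) by rewrite -{1}sA inE.
pose u := (s * tperm x (s x))%g.
have su : s = (u * tperm x (s x))%g by rewrite /u -mulgA tperm2 mulg1.
have uA : u @^-1: A = A.
  apply/setP => y; rewrite inE permM; case: tpermP => [E|E|_ _].
  - by rewrite -xA -E -{2}sA inE.
  - by rewrite xA -E -{2}sA inE.
  - by rewrite -{2}sA inE.
have pu : (p %| phi u)%Z.
  apply: IH => //; apply: leq_trans le_n; apply/proper_card/properP; split.
    apply/subsetP => y; rewrite !inE permM; apply: contra => /eqP sy.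
    rewrite sy; case: tpermP => // E; case/eqP: sx; first by rewrite -E.
    by apply: (@perm_inj _ s); rewrite -E.
  by exists x; rewrite !inE // permM tpermR eqxx.
have := homP _ _ uA (preim_tperm xA); rewrite -su.
by move=> H; apply: (dvdz_eqD H (rpredD pu (phi_tperm _ _ xA))); ring.
Qed.

(** * Set functions and the cokernel of the restriction to smaller sets *)

Section SetFunctions.
Variable T : finType.
Implicit Types (v w y : {set T} -> int) (A B C Z : {set T}).

Definition homogeneous (k : nat) v : Prop := forall A, v A != 0 -> #|A| = k.

(** In terms of the square-free polynomial with coefficient v A at the product
    of the variables in A, this is the sum of all partial derivatives. *)
Definition down v B : int := \sum_(x | x \notin B) v (x |: B).

Lemma down_ext v w B : v =1 w -> down v B = down w B.
Proof. by move=> vw; apply: eq_bigr => x _; rewrite vw. Qed.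

Lemma downB v w B : down (fun A => v A - w A) B = down v B - down w B.
Proof. by rewrite /down sumrB. Qed.

Lemma down_homogeneous k v : homogeneous k.+1 v -> homogeneous k (down v).
Proof.
move=> vk B; apply: contraNeq => Bk; rewrite /down big1 // => x xB.
apply/eqP; apply: contraNT Bk => /vk /eqP.
by rewrite cardsU1 xB add1n eqSS.
Qed.

Lemma subset_of_card_exists A k : (k <= #|A|)%N ->
  exists2 C : {set T}, C \subset A & #|C| = k.
Proof.
rewrite -bin_gt0 -(cards_draws A k) => /card_gt0P[C].
by rewrite inE => /andP[CA /eqP Ck]; exists C.
Qed.

Section Reach.
Variable j : nat.

Definition reach y : Prop :=
  exists2 w, homogeneous j.+1 w & forall Z, down w Z = y Z.

Lemma reach_ext y z : y =1 z -> reach y -> reach z.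
Proof. by move=> yz [w wj wy]; exists w => // Z; rewrite -yz. Qed.

Lemma reach0 : reach (fun=> 0).
Proof.
exists (fun=> 0); first by move=> A; rewrite eqxx.
by move=> Z; rewrite /down big1.
Qed.

Lemma reach_lin (a : int) y z : reach y -> reach z ->
  reach (fun Z => a * y Z + z Z).
Proof.
move=> [w wj wy] [t tj tz]; exists (fun Y => a * w Y + t Y) => [A|Z].
  by have [-> | /wj //] := eqVneq (w A) 0; rewrite mulr0 add0r => /tj.
by rewrite /down big_split -mulr_sumr -wy -tz.
Qed.

Lemma reach_sum (I : finType) (a : I -> int) (f : I -> {set T} -> int) :
  (forall i, reach (f i)) -> reach (fun Z => \sum_i a i * f i Z).
Proof.
move=> fP; apply: (@reach_ext (fun Z => \sum_(i <- index_enum I) a i * f i Z))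
  => //.
elim: (index_enum I) => [|i s IH].
  by apply: reach_ext reach0 => Z; rewrite big_nil.
by apply: reach_ext (reach_lin (a i) (fP i) IH) => Z; rewrite big_cons.
Qed.

(** Inside A :|: B, a set function depending only on the size i of the
    intersection with A is mapped to one of the same kind; the coefficients
    (-1)^i (i-1)! (j-i)! make the contributions cancel for 0 < i < j. *)
Lemma reach_disjoint A B : #|A| = j -> #|B| = j -> [disjoint A & B] ->
  reach (fun Z => j`!%:Z * ((-1) ^+ j * (Z == A)%:Z - (Z == B)%:Z)).
Proof.
move=> Aj Bj dAB.
(* Sets of j + 1 elements in A :|: B meet A, so that i >= 1 on the support. *)
pose coef i : int := (-1) ^+ i * (i.-1`! * (j - i)`!)%N%:Z.
pose w (Y : {set T}) : int :=
  if (Y \subset A :|: B) && (#|Y| == j.+1) then coef #|Y :&: A| else 0.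
exists w => [Y|Z]; first by rewrite /w; case: ifP => [/andP[_ /eqP]|];
  rewrite ?eqxx.
have AneqB : (0 < j)%N -> A != B.
  move=> j_gt0; apply: contraTneq dAB => <-; rewrite -setI_eq0 setIid.
  by rewrite -card_gt0 Aj.
have [ZAB|ZAB] := boolP ((Z \subset A :|: B) && (#|Z| == j)); last first.
  have ZnA : Z != A by apply: contraNneq ZAB => ->; rewrite subsetUl Aj eqxx.
  have ZnB : Z != B by apply: contraNneq ZAB => ->; rewrite subsetUr Bj eqxx.
  rewrite (negbTE ZnA) (negbTE ZnB) mulr0 subrr mulr0 /down big1 // => x xZ.
  rewrite /w; case: ifP => // /andP[xZAB /eqP];
    rewrite cardsU1 xZ add1n => -[Zj].
  case/negP: ZAB; rewrite Zj eqxx andbT; apply: subset_trans xZAB.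
  exact: subsetUr.
case/andP: ZAB => ZAB /eqP Zj; set i := #|Z :&: A|.
have le_ij : (i <= j)%N by rewrite -Zj subset_leq_card ?subsetIl.
have ZA : #|A :\: Z| = (j - i)%N by rewrite cardsD Aj setIC.
have ZB : #|B :\: Z| = i.
  have := cardsID A Z; rewrite -/i Zj.
  have -> : Z :\: A = B :&: Z.
    apply/setP => x; rewrite !inE; have := subsetP ZAB x; rewrite inE.
    have := disjointFr dAB (x := x).
    by case: (x \in A) => [->|] //=; case: (x \in Z) => //= [_ ->|];
      rewrite ?andbF.
  by have := cardsID Z B; rewrite Bj; lia.
have wA x : x \in A :\: Z -> w (x |: Z) = coef i.+1.
  rewrite inE => /andP[xZ xA]; rewrite /w subUset sub1set inE xA /= ZAB.
  rewrite cardsU1 xZ Zj add1n eqxx /=; congr coef.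
  rewrite setIUl (setIidPl _) ?sub1set // cardsU1 inE (negbTE xZ) /=.
  by rewrite add1n.
have wB x : x \in B :\: Z -> w (x |: Z) = coef i.
  rewrite inE => /andP[xZ xB]; rewrite /w subUset sub1set inE xB orbT /= ZAB.
  rewrite cardsU1 xZ Zj add1n eqxx /=; congr coef.
  have xA := disjointFl dAB xB.
  rewrite setIUl (_ : [set x] :&: A = set0) ?set0U //.
  by apply/setP => z; rewrite !inE; case: eqP => // ->; rewrite xA.
have wO x : x \notin A -> x \notin B -> w (x |: Z) = 0.
  move=> xA xB; rewrite /w; case: ifP => //.
  by rewrite subUset sub1set inE (negbTE xA) (negbTE xB).
have -> : down w Z = coef i.+1 *+ (j - i) + coef i *+ i.
  rewrite /down (bigID (mem A)) /=; congr (_ + _).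
    rewrite -ZA -sumr_const; apply: eq_big => x; rewrite ?inE // => xA.
    by rewrite wA // inE.
  transitivity (\sum_(x in B :\: Z) coef i); last by rewrite sumr_const ZB.
  rewrite big_mkcond [RHS]big_mkcond /=.
  apply: eq_bigr => x _; have := @wB x; have := @wO x; rewrite !inE.
  have := disjointFr dAB (x := x).
  case: (x \in Z); case: (x \in A); case: (x \in B) => //=.
  - by move=> /(_ isT).
  - by move=> _ _ /(_ isT).
  - by move=> _ /(_ isT isT).
rewrite -[_ *+ (j - i)]mulr_natl -[_ *+ i]mulr_natl /coef /= subnS !natz.
have [i0|i_gt0] := posnP i.
  have ZeB : Z = B.
    apply/eqP; rewrite eqEcard Zj Bj leqnn andbT; apply/subsetP => x xZ.
    have := subsetP ZAB x xZ; rewrite inE => /orP[xA|//].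
    by have := cards0_eq i0 => /setP/(_ x); rewrite !inE xZ xA.
  rewrite i0 subn0 mul0r addr0 expr1 fact0 mul1n ZeB eqxx.
  have [j0|j_gt0] := posnP j.
    have -> : B == A by apply/eqP;
      rewrite (cards0_eq (etrans Aj j0)) (cards0_eq (etrans Bj j0)).
    by rewrite j0 expr0 mulr1 subrr mulr0 mul0r.
  rewrite eq_sym (negbTE (AneqB j_gt0)) mulr0 sub0r.
  by rewrite -[in RHS](prednK j_gt0) factS prednK // PoszM /=; ring.
have ZnB : Z != B.
  apply: contraTneq i_gt0 => ZeB;
    rewrite /i ZeB (_ : B :&: A = set0) ?cards0 //.
  by apply/eqP; rewrite setI_eq0 disjoint_sym.
rewrite (negbTE ZnB) subr0; have [ij|ij] := ltnP i j.
  have -> : (Z == A) = false.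
    apply: contraTF ij => /eqP ZeA; rewrite /i ZeA setIid Aj ltnn //.
  rewrite !mulr0 -[in LHS](prednK i_gt0) factS /= prednK //.
  have -> : (j - i)%N = (j - i).-1.+1 by rewrite prednK // subn_gt0.
  rewrite factS exprS !PoszM /=.
  by ring.
have ij' : i = j by apply/eqP; rewrite eqn_leq le_ij ij.
have -> : Z == A.
  rewrite eqEcard Zj Aj leqnn andbT; apply/setIidPl/eqP.
  by rewrite eqEcard subsetIl -/i ij' Zj leqnn.
rewrite ij' subnn mul0r add0r fact0 muln1 mulr1.
have j_gt0 : (0 < j)%N by rewrite -ij'.
by rewrite -[in RHS](prednK j_gt0) factS prednK // PoszM /=; ring.
Qed.

Hypotheses (j_even : ~~ odd j) (T_big : (j.*2 < #|T|)%N).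

(* As j is even, the sign in reach_disjoint disappears. *)
Let reach_diff A B : Prop :=
  reach (fun Z => j`!%:Z * ((Z == A)%:Z - (Z == B)%:Z)).

Let reach_diff_trans A B C : reach_diff A B -> reach_diff C B -> reach_diff A C.
Proof.
move=> AB CB; apply: reach_ext (reach_lin (-1) CB AB) => Z; ring.
Qed.

(** Exchanging one element: both sets are disjoint from a common third one. *)
Let reach_diff_swap A a b : #|A| = j -> a \in A -> b \notin A ->
  reach_diff A (b |: A :\ a).
Proof.
move=> Aj aA bA.
have [|C CA Cj] := @subset_of_card_exists (~: (b |: A)) j.
  by have := cardsC (b |: A); rewrite cardsU1 bA Aj; move: T_big; lia.
have disj (D : {set T}) : D \subset b |: A -> [disjoint D & C].
  move=> DA; rewrite disjoint_sym disjoints_subset; apply: subset_trans CA _.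
  by rewrite setCS.
have reachC (D : {set T}) : D \subset b |: A -> #|D| = j -> reach_diff D C.
  move=> DA Dj; apply: reach_ext (reach_disjoint Dj Cj (disj D DA)) => Z.
  by rewrite -signr_odd (negbTE j_even) mul1r.
apply: (@reach_diff_trans _ C); apply: reachC => //.
- exact: subsetUr.
- by apply: setUS; apply: subD1set.
- by have := cardsD1 a A; rewrite cardsU1 !inE (negbTE bA) andbF aA Aj /=; lia.
Qed.

Lemma reach_set_diff A B : #|A| = j -> #|B| = j ->
  reach (fun Z => j`!%:Z * ((Z == A)%:Z - (Z == B)%:Z)).
Proof.
rewrite -/(reach_diff A B); have [n] := ubnP #|A :\: B|.
elim: n A => // n IH A; rewrite ltnS => le_n Aj Bj.
have [AB|] := boolP (A \subset B).
  have -> : A = B by apply/eqP; rewrite eqEcard AB Aj Bj leqnn.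
  by apply: reach_ext reach0 => Z; rewrite subrr mulr0.
case/subsetPn => a aA aB.
have /subsetPn[b bB bA] : ~~ (B \subset A).
  apply: contraNN aB => BA; suff -> : B = A by [].
  by apply/eqP; rewrite eqEcard BA Aj Bj leqnn.
have A'j : #|b |: A :\ a| = j.
  by have := cardsD1 a A; rewrite cardsU1 !inE (negbTE bA) andbF aA Aj /=; lia.
have A'B : reach_diff (b |: A :\ a) B.
  apply: IH => //; apply: leq_trans le_n; apply/proper_card/properP; split.
    apply/subsetP => x; rewrite !inE => /andP[xB] /orP[/eqP E|/andP[_ ->]].
      by rewrite E bB in xB.
    by rewrite xB.
  by exists a; rewrite !inE ?aA ?aB // eqxx /= orbF;
    apply: contraNN aB => /eqP->.
have := reach_lin 1 (reach_diff_swap Aj aA bA) A'B.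
by apply: reach_ext => Z; ring.
Qed.

(** Up to the factor j!, the sum of the values modulo j + 1 is the only
    obstruction: differences of two j-sets are in the image, and so is the sum
    of the j + 1 subsets of a set D with one element more. *)
Lemma reach_of_sum y : homogeneous j y -> (j.+1 %| (\sum_Z y Z)%R)%Z ->
  reach (fun Z => j`!%:Z * y Z).
Proof.
move=> yj /dvdzP[q yq].
have [|D _ Dj] := @subset_of_card_exists setT j.+1.
  by rewrite cardsT; move: T_big; lia.
have [d dD] : exists d, d \in D by apply/card_gt0P; rewrite Dj.
pose A0 := D :\ d.
have A0j : #|A0| = j by have := cardsD1 d D; rewrite dD Dj => -[].
have pointwise A : reach (fun Z => j`!%:Z * ((#|A| == j)%:Z * ((Z == A)%:Z - (Z
  == A0)%:Z))).
  have [Aj|Aj] := eqVneq #|A| j.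
    by apply: reach_ext (reach_set_diff Aj A0j) => Z; rewrite mul1r.
  by apply: reach_ext reach0 => Z; rewrite mul0r mulr0.
have reachD : reach (down (fun Y => (Y == D)%:Z)).
  exists (fun Y => (Y == D)%:Z) => // Y; by have [->|_] := eqVneq Y D;
    rewrite ?eqxx.
have downD Z : down (fun Y => (Y == D)%:Z) Z =
    \sum_(A : {set T}) (A \subset D)%:Z * (#|A| == j)%:Z * (Z == A)%:Z.
  rewrite [RHS](bigD1 Z) //= eqxx mulr1 [X in _ + X]big1 ?addr0; last first.
    by move=> A /negbTE AZ; rewrite [Z == A]eq_sym AZ mulr0.
  rewrite /down; have [/andP[ZD /eqP Zj]|ZD] := boolP ((Z \subset D) && (#|Z|
    == j)).
    have : #|D :\: Z| = 1%N by rewrite cardsD (setIidPr ZD) Dj Zj subSnn.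
    move=> /eqP/cards1P[x DZ]; have : x \in D :\: Z by rewrite DZ set11.
    rewrite inE => /andP[xZ xD].
    have xZD : x |: Z = D.
      apply/eqP; rewrite eqEcard cardsU1 xZ Zj Dj leqnn andbT subUset sub1set
        xD.
      exact: ZD.
    rewrite (bigD1 x) //= xZD eqxx ZD Zj eqxx big1 ?addr0 // => z /andP[zZ zx].
    case: eqP => // zZD; have : z \in D :\: Z by rewrite inE zZ -zZD setU11.
    by rewrite DZ inE (negbTE zx).
  rewrite big1 => [|x xZ].
    by move: ZD; case: (Z \subset D); case: (#|Z| == j).
  case: eqP => // xZD; case/negP: ZD; rewrite -{1}xZD subsetUr.
  by have := cardsU1 x Z; rewrite xZ xZD Dj add1n => -[<-]; rewrite eqxx.
have sumD : \sum_(A : {set T}) (A \subset D)%:Z * (#|A| == j)%:Z = j.+1%:Z.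
  rewrite (eq_bigr (fun A : {set T} => ((A \subset D) && (#|A| == j))%:Z));
    last first.
    by move=> A _; case: (A \subset D); case: (#|A| == j).
  have -> : j.+1 = #|[set A : {set T} | A \subset D & #|A| == j]|.
    by rewrite cards_draws Dj binSn.
  rewrite -sum1_card (big_morph Posz PoszD (erefl 0)) [RHS]big_mkcond /=.
  by apply: eq_bigr => A _; rewrite inE; case: ifP.
have split_sum (f : {set T} -> int) Z :
    \sum_(A : {set T}) f A * (j`!%:Z * ((#|A| == j)%:Z * ((Z == A)%:Z - (Z ==
      A0)%:Z))) =
    j`!%:Z * (\sum_(A : {set T}) f A * (#|A| == j)%:Z * (Z == A)%:Z
              - (Z == A0)%:Z * \sum_(A : {set T}) f A * (#|A| == j)%:Z).
  rewrite mulr_sumr -sumrB mulr_sumr; apply: eq_bigr => A _; ring.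
have R1 := reach_sum (fun A : {set T} => y A - q * (A \subset D)%:Z) pointwise.
apply: reach_ext (reach_lin (q * j`!%:Z) reachD R1) => Z.
have yE : \sum_(A : {set T}) y A * (#|A| == j)%:Z * (Z == A)%:Z = y Z.
  rewrite (bigD1 Z) //= eqxx mulr1 [X in _ + X]big1 ?addr0 => [|A /negbTE AZ].
    have [->|/yj ->] := eqVneq (y Z) 0; first by rewrite mul0r.
    by rewrite eqxx mulr1.
  by rewrite [Z == A]eq_sym AZ mulr0.
have yS : \sum_(A : {set T}) y A * (#|A| == j)%:Z = q * j.+1%:Z.
  rewrite -yq; apply: eq_bigr => A _.
  have [->|/yj ->] := eqVneq (y A) 0; first by rewrite mul0r.
  by rewrite eqxx mulr1.
rewrite downD split_sum.
have -> : \sum_(A : {set T}) (y A - q * (A \subset D)%:Z) * (#|A| == j)%:Z = 0.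
  rewrite (eq_bigr (fun A : {set T} => y A * (#|A| == j)%:Z
             - q * ((A \subset D)%:Z * (#|A| == j)%:Z))); last by move=> A _;
               ring.
  by rewrite sumrB yS -mulr_sumr sumD subrr.
have -> : \sum_(A : {set T}) (y A - q * (A \subset D)%:Z) * (#|A| == j)%:Z * (Z
  == A)%:Z
  = y Z - q * \sum_(A : {set T}) (A \subset D)%:Z * (#|A| == j)%:Z * (Z ==
    A)%:Z.
  by rewrite -yE mulr_sumr -sumrB; apply: eq_bigr => A _; ring.
ring.
Qed.

End Reach.
End SetFunctions.

(** * Alternating set functions *)

Section AlternatingFunctions.
Variable T : finType.
Implicit Types (v w f : {set T} -> int) (A B C X : {set T}) (l : seq (T * T)).

Fixpoint pair_entries l : seq T :=
  if l is (x, y) :: l' then [:: x, y & pair_entries l'] else [::].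

Lemma mem_pair_entries l x y :
  (x, y) \in l -> (x \in pair_entries l) && (y \in pair_entries l).
Proof.
elim: l => [//|[a b] l IH]; rewrite inE => /orP[/eqP[-> ->]|/IH/andP[xl yl]] /=.
  by rewrite !inE !eqxx !orbT.
by rewrite !inE xl yl !orbT.
Qed.

Lemma size_pair_entries l : size (pair_entries l) = (size l).*2.
Proof. by elim: l => [//|[a b] l /= ->]. Qed.

Lemma pair_neq l x y : uniq (pair_entries l) -> (x, y) \in l -> x != y.
Proof.
elim: l => // [[u v] l IH] /= /and3P[uv _ ul].
rewrite inE => /orP[/eqP[-> ->]|]; last exact: IH.
by move: uv; rewrite inE negb_or => /andP[].
Qed.

Definition antisymmetric_along l f : Prop :=
  forall x y, (x, y) \in l -> forall A, f (tperm x y @^-1: A) = - f A.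

Lemma antisymmetric_eq0 l f x y A : antisymmetric_along l f -> (x, y) \in l ->
  (x \in A) = (y \in A) -> f A = 0.
Proof. by move=> fl xyl xyA; have := fl x y xyl A; rewrite preim_tperm //;
  lia. Qed.

Lemma size_le_transversal l B : uniq (pair_entries l) ->
  (forall x y, (x, y) \in l -> (x \in B) || (y \in B)) -> (size l <= #|B|)%N.
Proof.
elim: l B => [//|[a b] l IH] B /= /and3P[];
  rewrite inE negb_or => /andP[_ al] bl ul lB.
have [d dB dl] : exists2 d, d \in B & d \notin pair_entries l.
  by have /orP[] := lB a b (mem_head _ _); [exists a | exists b].
rewrite (cardsD1 d) dB ltnS; apply: IH => // x y xyl.
have /andP[xl yl] := mem_pair_entries xyl; rewrite !inE.
have xd : x != d by apply: contraNneq dl => <-.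
have yd : y != d by apply: contraNneq dl => <-.
by rewrite xd yd /= lB // inE xyl orbT.
Qed.

(** A set B with fewer than size l elements misses some pair completely; only its
    two extensions by an element of that pair contribute, and they cancel. *)
Lemma down_antisymmetric l f B : uniq (pair_entries l) ->
  antisymmetric_along l f -> homogeneous (size l) f -> down f B = 0.
Proof.
move=> ul fl fh.
have [/hasP[[x y] xyl /= /norP[xB yB]]|/hasPn lB] :=
    boolP (has (fun q => ~~ ((q.1 \in B) || (q.2 \in B))) l); last first.
  rewrite /down big1 // => z zB; apply/eqP.
  have : (size l <= #|B|)%N.
    by apply: size_le_transversal ul _ => x y /lB /=; rewrite negbK.
  by apply: contraTT => /fh; rewrite cardsU1 zB add1n => <-; rewrite ltnn.
have xy := pair_neq ul xyl.
rewrite /down (bigD1 x) //= (bigD1 y) /=; last by rewrite yB eq_sym.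
rewrite big1 => [|z /andP[/andP[zB zx] zy]]; last first.
  apply: (antisymmetric_eq0 fl xyl).
  by rewrite !inE (negbTE xB) (negbTE yB) !orbF ![_ == z]eq_sym (negbTE zx)
    (negbTE zy).
have -> : y |: B = tperm x y @^-1: (x |: B).
  apply/setP => z; rewrite !inE; case: tpermP => [->|->|/eqP zx /eqP zy].
  - by rewrite (negbTE xB) (negbTE yB) eq_sym.
  - by rewrite !eqxx.
  - by rewrite (negbTE zx) (negbTE zy).
by rewrite fl // addr0 subrr.
Qed.

(** An antisymmetric function vanishes at A unless A meets each pair in one
    element, and any two such sets differ by swaps within pairs. *)
Lemma antisymmetric_determined l f A0 :
    antisymmetric_along l f -> homogeneous (size l) f ->
    #|A0| = size l -> (forall x y, (x, y) \in l -> y \in A0) ->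
    (forall a, a \in A0 -> exists2 x, x \notin A0 & (x, a) \in l) ->
  f A0 = 0 -> forall A, f A = 0.
Proof.
move=> fl fh A0l yA0 A0y fA0 A; have [n] := ubnP #|A0 :\: A|.
elim: n A => // n IH A; rewrite ltnS => le_n.
have [//|fA] := eqVneq (f A) 0; apply/eqP.
have Al := fh _ fA.
have [A0A|/subsetPn[y yA0' yA]] := boolP (A0 \subset A).
  by have -> : A = A0; [apply/esym/eqP;
    rewrite eqEcard A0A A0l Al leqnn | rewrite fA0].
have [x xA0 xyl] := A0y y yA0'.
have xA : x \in A.
  by apply: contraNT fA => xA;
    rewrite (antisymmetric_eq0 fl xyl) // (negbTE xA) (negbTE yA).
rewrite -oppr_eq0 -(fl x y) // IH //; apply: leq_trans le_n.
apply/proper_card/properP; split.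
  apply/subsetP => z; rewrite !inE; case: tpermP => [->|->|_ _].
  - by rewrite (negbTE xA0) andbF.
  - by rewrite xA.
  - by [].
by exists y; rewrite !inE ?yA ?yA0' // tpermR xA.
Qed.

(** When the entries of l are distinct, these functions are the multiples of the
    square-free polynomial prod (x - y) over the pairs (x, y) of l. *)
Definition alternating l f : Prop :=
  [/\ homogeneous (size l) f, antisymmetric_along l f &
      forall A, f A != 0 -> {subset A <= pair_entries l}].

(** Product with the linear form x - c, for square-free polynomials. *)
Definition extend_pair (x c : T) f A : int :=
  (x \in A)%:Z * f (A :\ x) - (c \in A)%:Z * f (A :\ c).

Lemma extend_pair_alternating x c l f : uniq (pair_entries ((x, c) :: l)) ->
  alternating l f -> alternating ((x, c) :: l) (extend_pair x c f).
Proof.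
rewrite /= inE negb_or => /and3P[/andP[xc xl] cl ul] [fh fl fs].
have f0 A z : z \in A -> z \notin pair_entries l -> f A = 0.
  by move=> zA zl; apply/eqP; apply: contraNT zl => /fs; apply.
have nz A : extend_pair x c f A != 0 ->
    (x \in A /\ f (A :\ x) != 0) \/ (c \in A /\ f (A :\ c) != 0).
  rewrite /extend_pair; case: (x \in A); case: (c \in A);
    rewrite ?mul1r ?mul0r ?subr0 ?sub0r ?oppr_eq0 ?eqxx //.
  - by have [->|] := eqVneq (f (A :\ x)) 0; [rewrite sub0r oppr_eq0;
    right | left].
  - by left.
  - by right.
split=> [A|y z|A].
- case/nz => -[zA /fh fz]; first by rewrite (cardsD1 x) zA fz.
  by rewrite (cardsD1 c) zA fz.
- rewrite inE => /orP[/eqP[-> ->] A|yzl A].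
    rewrite /extend_pair !inE tpermL tpermR.
    have E : (c \in A)%:Z * f (tperm x c @^-1: A :\ x) = (c \in A)%:Z * f (A :\
      c).
      have [cA|_] := boolP (c \in A); last by rewrite !mul0r.
      congr (_ * _); have [xA|xA] := boolP (x \in A).
        rewrite (f0 (A :\ c) x) ?inE ?xA ?xc //.
        by rewrite (f0 _ c) ?inE ?tpermR ?xA // andbT eq_sym.
      congr f; apply/setP => b; rewrite !inE;
        case: tpermP => [->|->|/eqP bx /eqP bc].
      - by rewrite eqxx (negbTE xA) andbF.
      - by rewrite eqxx (negbTE xA) andbF.
      - by rewrite bx bc.
    have E' : (x \in A)%:Z * f (tperm x c @^-1: A :\ c) = (x \in A)%:Z * f (A
      :\ x).
      have [xA|_] := boolP (x \in A); last by rewrite !mul0r.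
      congr (_ * _); have [cA|cA] := boolP (c \in A).
        rewrite (f0 (A :\ x) c) ?inE ?cA ?andbT 1?eq_sym //.
        by rewrite (f0 _ x) ?inE ?tpermL ?cA // andbT.
      congr f; apply/setP => b; rewrite !inE;
        case: tpermP => [->|->|/eqP bx /eqP bc].
      - by rewrite eqxx (negbTE cA) andbF.
      - by rewrite eqxx (negbTE cA) andbF.
      - by rewrite bx bc.
    by rewrite E E'; ring.
  have /andP[yl zl] := mem_pair_entries yzl.
  have out a : a \notin pair_entries l ->
      (a \in tperm y z @^-1: A) = (a \in A) /\
      f (tperm y z @^-1: A :\ a) = - f (A :\ a).
    move=> al; have ya : y != a by apply: contraNneq al => <-.
    have za : z != a by apply: contraNneq al => <-.
    split; first by rewrite inE tpermD.
    rewrite -(fl y z) //; congr f; apply/setP => b; rewrite !inE.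
    congr (_ && _); case: tpermP => [->|->|//]; rewrite ?ya ?za //.
  have [xA fx] := out x xl; have [cA fc] := out c cl.
  by rewrite /extend_pair xA cA fx fc; ring.
- case/nz => -[zA /fs sA] a aA; rewrite !inE.
    by have [//|ax] := eqVneq a x; rewrite sA ?orbT // !inE ax.
  by have [//|ac] := eqVneq a c; rewrite ?orbT // sA ?orbT // !inE ac.
Qed.

End AlternatingFunctions.

(** * The kernel of the restriction to smaller sets *)

Section KernelOfDown.
Variable T : finType.
Implicit Types (v w f : {set T} -> int) (A B C X : {set T}) (l : seq (T * T)).

Definition supported_on (k : nat) X v : Prop :=
  forall A, v A != 0 -> A \subset X /\ #|A| = k.

Lemma supported_homogeneous k X v : supported_on k X v -> homogeneous k v.
Proof. by move=> vX A /vX[]. Qed.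

Definition sum_between v B C : int :=
  \sum_(A : {set T} | (B \subset A) && [disjoint A & C]) v A.

(** Summing over the extensions of B by one element counts each k-set above B
    k - #|B| times; this descends from #|B| = k - 1, where the sum is down v B. *)
Lemma sum_above_eq0 k v B : homogeneous k v -> (forall A, down v A = 0) ->
  (#|B| < k)%N -> sum_between v B set0 = 0.
Proof.
move=> vk vd; have [n] := ubnP (k - #|B|)%N; elim: n B => // n IH B le_n lt_Bk.
pose s C := \sum_(A : {set T} | C \subset A) v A.
have sE C : sum_between v C set0 = s C.
  by apply: eq_bigl => A; rewrite disjoint_sym disjoints_subset sub0set andbT.
have top C : #|C| = k -> s C = v C.
  move=> Ck; rewrite /s (bigD1 C) //= big1 ?addr0 // => A /andP[CA AC].
  apply/eqP; apply: contraNT AC => /vk Ak.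
  by rewrite eq_sym eqEcard CA Ak Ck leqnn.
have count : \sum_(x | x \notin B) s (x |: B) = (k - #|B|)%:Z * s B.
  rewrite /s (exchange_big_dep (fun A => B \subset A)) /=; last first.
    by move=> x A _; rewrite subUset => /andP[].
  rewrite mulr_sumr; apply: eq_bigr => A BA.
  have [->|/vk Ak] := eqVneq (v A) 0; first by rewrite mulr0 big1.
  transitivity (\sum_(x in A :\: B) v A).
    by apply: eq_bigl => x; rewrite subUset sub1set BA andbT inE.
  by rewrite sumr_const cardsD (setIidPr BA) Ak -mulr_natl natz.
have sum0 : \sum_(x | x \notin B) s (x |: B) = 0.
  have [ltBk|geBk] := ltnP #|B|.+1 k.
    by rewrite big1 // => x xB; rewrite -sE IH // cardsU1 xB; lia.
  transitivity (down v B); last exact: vd.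
  apply: eq_bigr => x xB; apply: top.
  by rewrite cardsU1 xB; lia.
rewrite sE; move: count; rewrite sum0 => /esym/eqP; rewrite mulf_eq0.
by case/orP => [|/eqP //]; lia.
Qed.

Lemma sum_between_eq0 k v B C : homogeneous k v -> (forall A, down v A = 0) ->
  (#|B| + #|C| < k)%N -> sum_between v B C = 0.
Proof.
move=> vk vd; have [n] := ubnP #|C|; elim: n B C => // n IH B C.
have [->|[c cC]] := set_0Vmem C.
  by rewrite cards0 addn0 => _; apply: sum_above_eq0.
rewrite (cardsD1 c) cC => le_n lt_k.
have -> : sum_between v B C =
    sum_between v B (C :\ c) - sum_between v (c |: B) (C :\ c).
  rewrite [sum_between v B (C :\ c)](bigID (fun A => c \in A)) /=.
  rewrite [X in (X + _) - _](_ : _ = sum_between v (c |: B) (C :\ c));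
    last first.
    by apply: eq_bigl => A; rewrite subUset sub1set; case: (c \in A);
      rewrite ?andbT ?andbF.
  rewrite addrAC subrr add0r; apply: eq_bigl => A; rewrite -andbA;
    congr (_ && _).
  rewrite ![[disjoint A & _]]disjoint_sym !disjoints_subset.
  by rewrite -{1}(setD1K cC) subUset sub1set inE andbC.
rewrite !IH ?subrr //; try lia.
by have := cardsU1 c B; case: (c \in B) => /= ->; lia.
Qed.

(** If 2k > |X|, the complement in X of a k-set has fewer than k elements, so
    that inclusion-exclusion expresses the value at this set by vanishing sums. *)
Lemma down_injective k X v : supported_on k X v -> (forall A, down v A = 0) ->
  (#|X| < k.*2)%N -> forall A, v A = 0.
Proof.
move=> vX vd ltXk A; have [//|vA] := eqVneq (v A) 0.
have [AX Ak] := vX A vA.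
have := @sum_between_eq0 k v set0 (X :\: A) (supported_homogeneous vX) vd.
rewrite cards0 add0n cardsD (setIidPr AX) Ak => <-; last first.
  by move: (subset_leq_card AX) ltXk; rewrite Ak; lia.
rewrite /sum_between (bigD1 A) /=; last first.
  by rewrite sub0set disjoint_sym disjoints_subset setDE subsetIr.
rewrite big1 ?addr0 // => C /andP[/andP[_ dC] CA].
have [//|/vX[CX Ck]] := eqVneq (v C) 0; case/negP: CA.
rewrite eqEcard Ak Ck leqnn andbT; apply/subsetP => x xC.
have := disjointFr dC xC; rewrite inE (subsetP CX _ xC) andbT.
by move/negbFE.
Qed.

(** Splitting v = x u + w along an element x of X, the function u is in the
    kernel for X minus x, hence generated by alternating functions; multiplying
    each of them by x - c for some unused c and subtracting leaves a function in
    the kernel supported on X minus x.  The predicate P plays the role of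
    membership in the span. *)
Lemma down_kernel_generated X k v (P : ({set T} -> int) -> Prop) :
    supported_on k X v -> (forall A, down v A = 0) ->
    (forall f g, f =1 g -> P f -> P g) ->
    P (fun=> 0) -> (forall f g, P f -> P g -> P (fun A => f A - g A)) ->
    (forall l f, alternating l f -> uniq (pair_entries l) -> size l = k ->
       {subset pair_entries l <= X} -> P f) ->
  P v.
Proof.
have [n] := ubnP #|X|;
  elim: n X k v P => // n IH X k v P le_n vX vd Pext P0 PB Palt.
have [ltXk|leXk] := ltnP #|X| k.*2.
  by apply: Pext P0 => A; rewrite (down_injective vX vd).
case: k vX leXk Palt => [|k] vX leXk Palt.
  apply: (Palt [::]) => //; split=> // A; first by case/vX.
  by case/vX => _ /eqP; rewrite cards_eq0 => /eqP-> a; rewrite inE.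
have [x xX] : exists x, x \in X by apply/card_gt0P; apply: leq_trans leXk; lia.
have Xx := cardsD1 x X; rewrite xX add1n in Xx.
pose u A : int := if x \in A then 0 else v (x |: A).
have uX : supported_on k (X :\ x) u.
  move=> A; rewrite /u; case: ifPn => [|xA /vX[]]; first by rewrite eqxx.
  rewrite cardsU1 xA => sA [Ak]; split=> //; apply/subsetP => a aA.
  rewrite !inE (subsetP sA) ?inE ?aA ?orbT // andbT.
  by apply: contraNneq xA => <-.
have ud A : down u A = 0.
  rewrite /down; have [xA|xA] := boolP (x \in A).
    by rewrite big1 // => a _; rewrite /u inE xA orbT.
  transitivity (down v (x |: A)); last exact: vd.
  rewrite /down [LHS](bigID (pred1 x)) /= [X in X + _]big1 ?add0r; last first.
    by move=> a /andP[_ /eqP->]; rewrite /u setU11.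
  apply: eq_big => a; first by rewrite !inE negb_or andbC.
  move=> /andP[aA ax]; rewrite /u !inE eq_sym (negbTE ax) (negbTE xA) /=.
  by congr v; rewrite setUCA.
(* Membership of f in the span for X minus x, carried to X by a multiplication. *)
pose Q f := exists f', [/\ P f', supported_on k.+1 X f',
   forall A, down f' A = 0 & forall A, x \notin A -> f' (x |: A) = f A].
have ltXn : (#|X :\ x| < n)%N by move: le_n Xx; lia.
have sub_alt l f : alternating l f -> size l = k.+1 -> {subset pair_entries l
  <= X} ->
    supported_on k.+1 X f.
  move=> [fh _ fs] lk lX A fA; split; last by rewrite (fh _ fA).
  by apply/subsetP => a aA; apply/lX/(fs A).
have [u' [Pu' u'X u'd u'E]] : Q u.
  apply: (IH (X :\ x) k u Q) => //.
  - move=> f g fg [f' [Pf f'X f'd f'E]]; exists f'; split=> // A xA.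
    by rewrite f'E // fg.
  - exists (fun=> 0); split=> // A; by rewrite /down big1.
  - move=> f g [f' [Pf f'X f'd f'E]] [g' [Pg g'X g'd g'E]].
    exists (fun A => f' A - g' A); split; first exact: PB.
    + move=> A; have [->|/f'X //] := eqVneq (f' A) 0.
      by rewrite sub0r oppr_eq0 => /g'X.
    + by move=> A; rewrite downB f'd g'd subrr.
    + by move=> A xA; rewrite f'E // g'E.
  - move=> l f fl ul lk lX.
    have xl : x \notin pair_entries l by apply/negP => /lX; rewrite !inE eqxx.
    have [c cX cl] : exists2 c, c \in X :\ x & c \notin pair_entries l.
      apply/subsetPn; apply/negP => Xl.
      have : (#|X :\ x| <= size (pair_entries l))%N.
        apply: leq_trans (card_size _); exact: subset_leq_card.
      by rewrite size_pair_entries lk; move: leXk Xx; lia.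
    have xc : x != c by move: cX; rewrite !inE eq_sym => /andP[].
    have uxcl : uniq (pair_entries ((x, c) :: l)).
      by rewrite /= inE negb_or xc xl cl ul.
    have altf := extend_pair_alternating uxcl fl.
    have lkS : size ((x, c) :: l) = k.+1 by rewrite /= lk.
    have lXS : {subset pair_entries ((x, c) :: l) <= X}.
      move=> a; rewrite /= !inE => /or3P[/eqP->|/eqP->|/lX] //.
        by move: cX; rewrite inE => /andP[].
      by rewrite inE => /andP[].
    exists (extend_pair x c f); split.
    + exact: Palt altf uxcl lkS lXS.
    + exact: sub_alt altf lkS lXS.
    + by case: altf => fh fa _ A; apply: down_antisymmetric uxcl fa fh.
    + move=> A xA; rewrite /extend_pair setU11 mul1r setU1K // !inE eq_sym
      (negbTE xc) /=.
      suff -> : f ((x |: A) :\ c) = 0 by rewrite mulr0 subr0.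
      apply/eqP; apply: contraNT xl => fA; case: fl => _ _ fs.
      by apply: (fs _ fA); rewrite !inE xc eqxx.
pose w A := v A - u' A.
have wX : supported_on k.+1 (X :\ x) w.
  move=> A wA.
  have [AX Ak] : A \subset X /\ #|A| = k.+1.
    move: wA; rewrite /w; have [->|/vX //] := eqVneq (v A) 0.
    by rewrite sub0r oppr_eq0 => /u'X.
  split=> //; apply/subsetP => a aA; rewrite !inE (subsetP AX) // andbT.
  apply: contraNneq wA => ax; rewrite ax {ax a} in aA.
  by rewrite /w -(setD1K aA) u'E ?setD11 // /u setD11 subrr.
have Pw : P w.
  apply: (IH (X :\ x) k.+1 w P) => // [A|l f fl ul lk lX].
    by rewrite downB vd u'd subrr.
  apply: Palt fl ul lk _ => a /lX; by rewrite inE => /andP[].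
apply: Pext (PB _ _ Pw (PB _ _ P0 Pu')) => A.
by rewrite /w; ring.
Qed.

End KernelOfDown.

(** * Tableaux and polytabloids *)

Section Tableaux.
Variable lam : seq nat.
Local Notation n := (sumn lam).
Implicit Types (t : tableau lam) (s : 'S_n) (X : tabloid lam).

Lemma node_eq (c d : node lam) :
  node_row c = node_row d :> nat -> node_col c = node_col d -> c = d.
Proof.
case: c d => [i j] [i' j'] /= /val_inj E; case: i' / E j' => j' /val_inj /= E.
by rewrite E.
Qed.

Lemma sum_node (F : node lam -> nat) :
  (\sum_c F c = \sum_(i < size lam) \sum_(j < nth 0%N lam i)
     F (Tagged (fun i : 'I_(size lam) => 'I_(nth 0%N lam i)) j))%N.
Proof.
rewrite (sig_big_dep (op := addn) (I := 'I_(size lam))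
  (J := fun i : 'I_(size lam) => 'I_(nth 0%N lam i)) xpredT (fun _ => xpredT)
    (fun i j =>
  F (Tagged (fun i : 'I_(size lam) => 'I_(nth 0%N lam i)) j))).
by apply: eq_bigr => -[].
Qed.

Lemma card_node : #|{: node lam}| = n.
Proof.
rewrite -sum1_card sum_node sumnE (big_nth 0%N) big_mkord.
by apply: eq_bigr => i _; rewrite sum1_card card_ord.
Qed.

Lemma tableau_bij t : bijective (val t).
Proof.
by apply: (inj_card_bij (injectiveP _ (valP t))); rewrite card_ord card_node.
Qed.

Lemma sum_tableau t (F : node lam -> nat) :
  (\sum_k F (val t k) = \sum_c F c)%N.
Proof. by rewrite [RHS](reindex (val t)) //; apply/onW_bij/tableau_bij. Qed.

Lemma tableau_trans t t' : exists s, t' = tableau_act s t.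
Proof.
have [g tK gK] := tableau_bij t.
have s_inj : injective (fun k => g (val t' k)).
  move=> k k' /(can_inj gK); exact: (injectiveP _ (valP t')).
exists (perm s_inj); apply/val_inj/ffunP => k.
by rewrite !ffunE permE gK.
Qed.

Lemma column_stabiliserP t s :
  reflect (forall k, node_col (val t (s k)) = node_col (val t k))
          (s \in column_stabiliser t).
Proof. by rewrite inE; apply: (iffP forallP) => H k; apply/eqP. Qed.

Lemma polytabloidE t X : polytabloid t X =
  \sum_(s in column_stabiliser t)
     (X == tabloid_act s (tabloid_of t))%:Z * (-1) ^+ odd_perm s.
Proof.
rewrite /polytabloid sum_ffunE; apply: eq_bigr => s _.
rewrite tabloid_of_act ffunMzE ffunE -mulrzr intz natz.
by [].
Qed.

Lemma polytabloid_column t s X : s \in column_stabiliser t ->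
  polytabloid t (tabloid_act s X) = (-1) ^+ odd_perm s * polytabloid t X.
Proof.
move=> sC; rewrite !polytabloidE mulr_sumr (reindex_inj (mulgI s)) /=.
have /column_stabiliserP sP := sC.
apply: eq_big => [u|u _].
  apply/column_stabiliserP/column_stabiliserP => H k.
    by have := H (s^-1 k)%g; rewrite permM permKV -(sP (s^-1 k)%g) permKV.
  by rewrite permM H sP.
rewrite odd_permM signr_addb mulrCA; congr (_ * (Posz (nat_of_bool _) * _)).
rewrite tabloid_actM; apply/eqP/eqP => [E|-> //].
by rewrite -[X]tabloid_act1 -(mulVg s) tabloid_actM E -tabloid_actM mulVg
  tabloid_act1.
Qed.

Lemma polytabloid_self t : polytabloid t (tabloid_of t) = 1.
Proof.
rewrite polytabloidE (bigD1 1%g) /=; last by apply/column_stabiliserP => k;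
  rewrite perm1.
rewrite tabloid_act1 eqxx odd_perm1 expr0 mulr1 big1 ?addr0 // => s /andP[sC
  s1].
case: eqP => [/(congr1 val)/ffunP E|]; last by rewrite mul0r.
case/eqP: s1; apply/permP => k; rewrite perm1.
apply: (injectiveP _ (valP t)); apply: node_eq; last exact/column_stabiliserP.
by have := E k; rewrite !ffunE => ->.
Qed.

Lemma polytabloid_specht t (z : int) : polytabloid t *~ z \in @specht_pred lam.
Proof.
apply/asboolP; exists (fun u => if u == t then z else 0).
rewrite (bigD1 t) //= eqxx big1 ?addr0 // => u /negbTE->; exact: mulr0z.
Qed.

End Tableaux.

(** * The sum of all transpositions on a Specht lattice *)

Section TranspositionSum.
Variable lam : seq nat.
Hypothesis lam_sorted : sorted geq lam.
Local Notation n := (sumn lam).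
Implicit Types (t : tableau lam) (s : 'S_n) (X Y : tabloid lam).

Definition column_antisymmetrizer t Y : perm_module lam :=
  \sum_(s in column_stabiliser t)
     tabloid_vec (tabloid_act s Y) *~ ((-1) ^+ odd_perm s).

Lemma polytabloid_antisymmetrizer t :
  polytabloid t = column_antisymmetrizer t (tabloid_of t).
Proof. by apply: eq_bigr => s _; rewrite tabloid_of_act. Qed.

Lemma antisymmetrizer_column t s Y : s \in column_stabiliser t ->
  column_antisymmetrizer t (tabloid_act s Y) =
  column_antisymmetrizer t Y *~ ((-1) ^+ odd_perm s).
Proof.
move=> sC; rewrite /column_antisymmetrizer mulrz_suml.
rewrite [RHS](reindex_inj (mulIg s)) /=.
have /column_stabiliserP sP := sC.
apply: eq_big => [u|u _].
  apply/column_stabiliserP/column_stabiliserP => H k.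
    by rewrite permM sP H.
  by rewrite -(H k) permM sP.
rewrite -tabloid_actM -mulrzA odd_permM signr_addb -mulrA -signr_addb addbb.
by rewrite mulr1.
Qed.

(** The transposition of x and y fixes Y and changes the sign of the
    antisymmetrizer. *)
Lemma antisymmetrizer_eq0 t Y x y : x != y ->
  node_col (val t x) = node_col (val t y) -> val Y x = val Y y ->
  column_antisymmetrizer t Y = 0.
Proof.
move=> xy colxy rowxy.
have sC : tperm x y \in column_stabiliser t.
  by apply/column_stabiliserP => k; case: tpermP => [->|->|].
have := antisymmetrizer_column Y sC; rewrite odd_tperm xy expr1.
have -> : tabloid_act (tperm x y) Y = Y.
  by apply/val_inj/ffunP => k; rewrite ffunE; case: tpermP => [->|->|].
move=> E; apply/ffunP => X; rewrite ffunE.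
have /ffunP/(_ X) := E; rewrite ffunMzE mulrN1z; set a : int := _ X; move=> aN.
by lia.
Qed.

Definition same_row t (q : 'I_n * 'I_n) : bool :=
  node_row (val t q.1) == node_row (val t q.2).
Definition same_col t (q : 'I_n * 'I_n) : bool :=
  node_col (val t q.1) == node_col (val t q.2).

(** If x and y lie in different rows and columns, the higher of the two rows
    meets the column of the letter in the lower row, because lam is a
    partition; this puts two letters of one column of t in one row of the
    transposed tabloid. *)
Lemma antisymmetrizer_tperm t x y :
  column_antisymmetrizer t (tabloid_act (tperm x y) (tabloid_of t)) =
  polytabloid t *~
    ((same_row t (x, y))%:Z - (same_col t (x, y))%:Z + (x == y)%:Z).
Proof.
rewrite /same_row /same_col /=.
have [<-|xy] := eqVneq x y.
  by rewrite !eqxx tperm1 tabloid_act1 polytabloid_antisymmetrizer.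
have [rowxy|rowxy] := eqVneq (node_row (val t x)) (node_row (val t y)).
  have -> : (node_col (val t x) == node_col (val t y)) = false.
    apply: contra_neqF xy => /eqP; move/(congr1 val): rowxy => /node_eq E /E.
    exact: (injectiveP _ (valP t)).
  have -> : tabloid_act (tperm x y) (tabloid_of t) = tabloid_of t.
    by apply/val_inj/ffunP => k; rewrite !ffunE; case: tpermP => [->|->|].
  by rewrite polytabloid_antisymmetrizer.
have [colxy|colxy] := eqVneq (node_col (val t x)) (node_col (val t y)).
  rewrite antisymmetrizer_column ?odd_tperm ?xy -?polytabloid_antisymmetrizer
    //.
  by apply/column_stabiliserP => k; case: tpermP => [->|->|].
rewrite mulr0z; wlog lt_xy : x y xy rowxy colxy /
    (node_row (val t x) < node_row (val t y))%N => [IH|].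
  case: (ltngtP (node_row (val t x)) (node_row (val t y))) =>
    [|lt_yx|/val_inj/eqP].
  - exact: IH.
  - by rewrite tpermC IH // eq_sym.
  - by rewrite (negbTE rowxy).
set i := node_row (val t x); set i' := node_row (val t y).
have le_lam : (nth 0%N lam i' <= nth 0%N lam i)%N.
  have geq_trans : transitive geq by move=> a b c; rewrite /geq /= => ab bc;
    apply: leq_trans bc ab.
  apply: (sorted_ltn_nth geq_trans) => //; rewrite inE; exact: ltn_ord.
have colP : (node_col (val t y) < nth 0%N lam i)%N.
  by apply: leq_trans le_lam; rewrite /node_col ltn_ord.
have [g tK gK] := tableau_bij t.
pose c : node lam := Tagged (fun i : 'I_(size lam) => 'I_(nth 0%N lam i))
  (Ordinal colP).
have gc : val t (g c) = c := gK c.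
have yw : y != g c.
  by apply: contraNneq rowxy => ->; rewrite gc.
have xw : x != g c.
  by apply: contraNneq colxy => ->; rewrite gc.
apply: (antisymmetrizer_eq0 yw); first by rewrite gc.
by rewrite !ffunE tpermR tpermD // gc.
Qed.

(** The action of the sum over all ordered pairs of letters on the polytabloid of
    t, in which the pairs (x, x) contribute the identity. *)
Definition content_scalar t : int :=
  \sum_q ((same_row t q)%:Z - (same_col t q)%:Z + (q.1 == q.2)%:Z).

(** Centrality: the sum may be moved past the column antisymmetrizer, to act on
    the tabloid of t first. *)
Lemma transposition_sum_polytabloid t :
  \sum_(q : 'I_n * 'I_n) perm_module_act (tperm q.1 q.2) (polytabloid t) =
  polytabloid t *~ content_scalar t.
Proof.
rewrite /content_scalar mulrz_sumr.
rewrite -(eq_bigr _ (fun q _ => antisymmetrizer_tperm t q.1 q.2)) /=.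
rewrite [RHS]exchange_big /=.
under eq_bigr do rewrite /polytabloid raddf_sum.
rewrite exchange_big; apply: eq_bigr => s _ /=.
rewrite [RHS](reindex_inj (h := fun q : 'I_n * 'I_n => (s q.1, s q.2))) /=;
  last first.
  by move=> [a b] [c d] [/perm_inj -> /perm_inj ->].
apply: eq_bigr => q _; rewrite raddfMz /= perm_module_act_vec tabloid_of_act.
by rewrite -!tabloid_actM -tpermJ conjgE mulgA mulgV mul1g.
Qed.

Lemma sum_eq_minn (a b : nat) :
  (\sum_(j < a) \sum_(j' < b) (j == j' :> nat) = minn a b)%N.
Proof.
rewrite -(card_ord (minn a b)) -sum1_card.
rewrite (big_ord_widen_cond a xpredT (fun=> 1%N)) ?geq_minl // [RHS]big_mkcond
  /=.
apply: eq_bigr => j _; rewrite leq_min ltn_ord /=.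
case: ltnP => [lt_jb|le_bj].
  rewrite (bigD1 (Ordinal lt_jb)) //= eqxx big1 // => j'.
  by rewrite -val_eqE eq_sym /= => /negbTE->.
by rewrite big1 // => j' _; rewrite gtn_eqF // (leq_trans (ltn_ord j')).
Qed.

(** Twice the sum of the contents of lam, plus n: the double sum of minima is the
    sum of the squares of the column lengths. *)
Definition content_sum : int :=
  (\sum_(i < size lam) nth 0%N lam i ^ 2)%N%:Z
  - (\sum_(i < size lam) \sum_(i' < size lam) minn (nth 0%N lam i) (nth 0%N lam
    i'))%N%:Z
  + n%:Z.

Lemma content_scalarE t : content_scalar t = content_sum.
Proof.
rewrite /content_scalar big_split sumrB /=.
have natsum (F : 'I_n * 'I_n -> nat) : \sum_q (F q)%:Z = (\sum_x \sum_y F (x,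
  y))%N%:Z.
  by rewrite pair_bigA /= (big_morph Posz PoszD (erefl 0));
    apply: eq_bigr => -[].
have -> : \sum_q (same_row t q)%:Z = (\sum_(i < size lam) nth 0%N lam i ^
  2)%N%:Z.
  rewrite natsum; congr Posz.
  rewrite (sum_tableau t (fun c => \sum_y (node_row c == node_row (val t
    y)))%N) sum_node.
  apply: eq_bigr => i _; rewrite (eq_bigr (fun=> nth 0%N lam i)) => [|j _].
    by rewrite sum_nat_const card_ord expnS expn1.
  rewrite /node_row /=.
  rewrite (sum_tableau t (fun d => (i == node_row d) : nat)) sum_node (bigD1 i)
    //=.
  rewrite [X in (_ + X)%N]big1 ?addn0 => [|i' i'i]; last first.
    by rewrite big1 // => j' _; rewrite /node_row /= eq_sym (negbTE i'i).
  rewrite (eq_bigr (fun=> 1%N)) ?sum1_card ?card_ord // => j' _.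
  by rewrite /node_row /= eqxx.
have -> : \sum_q (same_col t q)%:Z =
    (\sum_(i < size lam) \sum_(i' < size lam) minn (nth 0%N lam i) (nth 0%N lam
      i'))%N%:Z.
  rewrite natsum; congr Posz.
  rewrite (sum_tableau t (fun c => \sum_y (node_col c == node_col (val t
    y)))%N) sum_node.
  apply: eq_bigr => i _.
  under [in RHS]eq_bigr do rewrite -sum_eq_minn.
  rewrite [RHS]exchange_big; apply: eq_bigr => j _ /=.
  by rewrite (sum_tableau t (fun d => (node_col _ == node_col d) : nat))
    sum_node.
congr (_ + _); rewrite natsum; congr Posz.
rewrite (eq_bigr (fun=> 1%N)) ?sum1_card ?card_ord // => x _ /=.
by rewrite (bigD1 x) //= eqxx big1 // => y; rewrite eq_sym => /negbTE->.
Qed.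

Lemma specht_content_torsion (u : H2 (specht lam)) :
  u *~ (content_sum - (n * n)%N%:Z) = 0.
Proof.
have -> : (n * n)%N = #|{: 'I_n * 'I_n}| by rewrite card_prod card_ord.
apply: (class_sum_scalar (x := fun q => tperm q.1 q.2)
  (conj := fun (s : 'S_n) q => (s q.1, s q.2))) => [s|s q|v].
- by move=> [a b] [c d] [/perm_inj -> /perm_inj ->].
- by rewrite /= tpermJ.
apply/val_inj; rewrite raddf_sum raddfMz /=.
have /asboolP[a ->] := valP v.
rewrite mulrz_suml.
under eq_bigr => q _ do rewrite raddf_sum /=.
rewrite exchange_big; apply: eq_bigr => t _ /=.
under eq_bigr => q _ do rewrite raddfMz /=.
by rewrite -mulrz_suml transposition_sum_polytabloid content_scalarE -!mulrzA
  mulrC.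
Qed.

End TranspositionSum.

Lemma not_dvd_order_annihilated (p : nat) (A : zmodType) (z : int) :
  prime p -> ~~ (p %| z)%Z -> (forall u : A, u *~ z = 0) -> ~ dvd_order p A.
Proof.
move=> p_pr pz Az /(dvd_order_torsion p_pr)[x x0 px]; case/eqP: x0.
apply: (@coprime_torsion _ p `|z|%N) => //;
  rewrite ?prime_coprime ?prime_gt0 //.
by case: (z) Az => k; rewrite /= ?NegzE => /(_ x);
  rewrite ?mulrNz ?pmulrn // => /eqP; rewrite oppr_eq0 => /eqP.
Qed.

(** - 2 b (a + 1) is twice the difference of the content sums of (a, b) and of the
    one-row partition (a + b). *)
Lemma two_row_not_dvd_order (p a b : nat) : prime p -> (2 < p)%N -> (b <= a)%N
  ->
  ~~ (p %| b * a.+1)%N -> ~ dvd_order p (H2 (specht [:: a; b])).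
Proof.
move=> p_pr p_gt2 ba pab; have srt : sorted geq [:: a; b] by rewrite /= andbT.
apply: (not_dvd_order_annihilated p_pr _ (specht_content_torsion srt)).
have -> : content_sum [:: a; b] - (sumn [:: a; b] * sumn [:: a; b])%N%:Z
    = - (2 * (b * a.+1))%N%:Z.
  rewrite /content_sum /= !big_ord_recl !big_ord0 /= !minnn (minn_idPr ba)
    (minn_idPl ba).
  nia.
by rewrite rpredN dvdzE /= Euclid_dvdM // negb_or pab andbT gtnNdvd.
Qed.

(** - 2 (a + 2) (b + 1) is twice the difference of the content sums of (a, b, 1)
    and of the one-row partition (a + b + 1). *)
Lemma three_row_not_dvd_order (p a b : nat) : prime p -> (2 < p)%N -> (b <=
  a)%N -> (0 < b)%N ->
  ~~ (p %| a.+2 * b.+1)%N -> ~ dvd_order p (H2 (specht [:: a; b; 1%N])).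
Proof.
move=> p_pr p_gt2 ba b_gt0 pab.
have srt : sorted geq [:: a; b; 1%N] by rewrite /= andbT ba.
apply: (not_dvd_order_annihilated p_pr _ (specht_content_torsion srt)).
have a_gt0 := leq_trans b_gt0 ba.
have -> : content_sum [:: a; b; 1%N] - (sumn [:: a; b; 1%N] * sumn [:: a; b;
  1%N])%N%:Z
    = - (2 * (a.+2 * b.+1))%N%:Z.
  rewrite /content_sum /= !big_ord_recl !big_ord0 /= !minnn (minn_idPr ba)
    (minn_idPl ba).
  rewrite (minn_idPr a_gt0) (minn_idPl a_gt0) (minn_idPr b_gt0) (minn_idPl
    b_gt0).
  nia.
by rewrite rpredN dvdzE /= Euclid_dvdM // negb_or pab andbT gtnNdvd.
Qed.

(** * Permutation modules on subsets *)

Section SubsetAction.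
Variable T : finType.
Implicit Types (A B : {set T}) (s : {perm T}).

Lemma perm_of_enumerations (r1 r2 : seq T) : uniq r1 -> uniq r2 ->
    size r1 = #|T| -> size r2 = #|T| ->
  exists s : {perm T}, forall x, index (s x) r1 = index x r2.
Proof.
move=> u1 u2 s1 s2.
have mem2 x : x \in r2.
  have : #|r2| = #|T| by rewrite (card_uniqP u2).
  by move/subset_cardP; move/(_ (subset_predT _)) => ->.
have lt2 x : (index x r2 < size r1)%N by rewrite s1 -s2 index_mem.
have f_inj : injective (fun x => nth x r1 (index x r2)).
  move=> x y; rewrite (set_nth_default y x (lt2 x)) => /eqP.
  rewrite nth_uniq // => /eqP E.
  by rewrite -(nth_index x (mem2 x)) E nth_index.
by exists (perm f_inj) => x; rewrite permE index_uniq.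
Qed.

Lemma preim_subset_trans A B : #|A| = #|B| -> exists s : {perm T}, s @^-1: A =
  B.
Proof.
move=> AB.
have ru (C : {set T}) : uniq (enum C ++ enum (~: C)).
  rewrite cat_uniq !enum_uniq andbT /=; apply/hasPn => x.
  by rewrite !mem_enum inE.
have rs (C : {set T}) : size (enum C ++ enum (~: C)) = #|T|.
  by rewrite size_cat -!cardE cardsC.
have idx (C : {set T}) x : (index x (enum C ++ enum (~: C)) < #|C|)%N = (x \in
  C).
  rewrite index_cat mem_enum; have [xC|xC] := boolP (x \in C).
    by rewrite cardE index_mem mem_enum.
  by rewrite -cardE ltnNge leq_addr.
have [s sP] := perm_of_enumerations (ru A) (ru B) (rs A) (rs B).
by exists s; apply/setP => x; rewrite inE -idx sP AB idx.
Qed.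

Variable k : nat.

Definition ksubset : Type := {A : {set T} | #|A| == k}.
HB.instance Definition _ := Finite.on ksubset.

Lemma ksubset_act_subproof s (A : ksubset) : #|s @^-1: val A| == k.
Proof. by rewrite card_preimset ?(valP A) //; apply: perm_inj. Qed.
Definition ksubset_act s (A : ksubset) : ksubset :=
  exist _ (s @^-1: val A) (ksubset_act_subproof s A).

Lemma ksubset_act1 (A : ksubset) : ksubset_act 1%g A = A.
Proof. by apply/val_inj/setP => x; rewrite inE perm1. Qed.

Lemma ksubset_actM s u (A : ksubset) : ksubset_act (s * u)%g A = ksubset_act s
  (ksubset_act u A).
Proof. by apply/val_inj/setP => x; rewrite !inE permM. Qed.

Lemma ksubset_act_trans (A B : ksubset) : exists s, ksubset_act s A = B.
Proof.
have [|s sE] := @preim_subset_trans (val A) (val B).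
  by rewrite (eqP (valP A)) (eqP (valP B)).
by exists s; apply/val_inj.
Qed.

Lemma card_ksubset : #|{: ksubset}| = 'C(#|T|, k).
Proof. by rewrite card_sig -card_draws; apply: eq_card => A; rewrite inE. Qed.

Definition ksubset_module := permutation_gmodule ksubset_act1 ksubset_actM.

Definition extend_ksubset (y : {ffun ksubset -> int}) (B : {set T}) : int :=
  oapp y 0 (insub B).

Lemma extend_ksubset_val y (B : ksubset) : extend_ksubset y (val B) = y B.
Proof. by rewrite /extend_ksubset valK. Qed.

Lemma extend_ksubset_homogeneous y : homogeneous k (extend_ksubset y).
Proof.
move=> B; rewrite /extend_ksubset; case: insubP => [C /eqP //|_].
by rewrite eqxx.
Qed.

Definition ksubset_sum (y : ksubset_module) : int :=
  \sum_B (y : {ffun ksubset -> int}) B.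

Lemma ksubset_sum_is_zmod_morphism : zmod_morphism ksubset_sum.
Proof.
by move=> y z; rewrite /ksubset_sum -sumrB; apply: eq_bigr => B _;
  rewrite !ffunE.
Qed.
HB.instance Definition _ := GRing.isZmodMorphism.Build ksubset_module int
  ksubset_sum ksubset_sum_is_zmod_morphism.

Lemma sum_homogeneous (f : {set T} -> int) : homogeneous k f ->
  \sum_A f A = \sum_(B : ksubset) f (val B).
Proof.
move=> fk; rewrite (bigID (fun A => #|A| == k)) /= [X in _ + X]big1 ?addr0.
  rewrite (reindex_omap (val : ksubset -> {set T}) insub) /=; last first.
    by move=> A Ak; rewrite (insubT (fun A => #|A| == k) Ak).
  by apply: eq_bigl => B; rewrite valK eqxx (valP B).
by move=> A; apply: contraNeq => /fk ->.
Qed.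

Lemma ksubset_sum_extend (y : ksubset_module) :
  \sum_A extend_ksubset y A = ksubset_sum y.
Proof.
rewrite sum_homogeneous; last exact: extend_ksubset_homogeneous.
by apply: eq_bigr => B _; rewrite extend_ksubset_val.
Qed.

Lemma ksubset_sum_act s (y : ksubset_module) :
  ksubset_sum (gact s y) = ksubset_sum y.
Proof.
rewrite /ksubset_sum [RHS](reindex (ksubset_act s^-1%g)).
  by apply: eq_bigr => B _; rewrite ffunE.
by exists (ksubset_act s) => B _;
  rewrite -ksubset_actM ?mulVg ?mulgV ksubset_act1.
Qed.

Lemma ksubset_sum_invariant (y : ksubset_module) :
  (forall s, gact s y = y) -> (('C(#|T|, k))%:Z %| ksubset_sum y)%Z.
Proof.
move=> yP; case: (pickP (mem {: ksubset})) => [B0 _|none].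
  rewrite /ksubset_sum (eq_bigr (fun=> (y : {ffun ksubset -> int}) B0)) => [|B
    _].
    by rewrite sumr_const card_ksubset -mulr_natr natz dvdz_mull.
  have [s <-] := ksubset_act_trans B0 B.
  by have /ffunP/(_ (ksubset_act s B0)) := yP s;
    rewrite ffunE -ksubset_actM mulVg ksubset_act1.
by rewrite /ksubset_sum big1 ?dvdz0 // => B; move: (none B); rewrite inE.
Qed.

End SubsetAction.

(** Every set A is hit once for each of its elements. *)
Lemma sum_down (T : finType) (k : nat) (f : {set T} -> int) :
  homogeneous k f -> \sum_B down f B = k%:Z * \sum_A f A.
Proof.
move=> fk; rewrite /down (exchange_big_dep xpredT) //= mulr_sumr.
rewrite (eq_bigr (fun x => \sum_(A : {set T} | x \in A) f A)) => [|x _].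
  rewrite (exchange_big_dep xpredT) //=; apply: eq_bigr => A _.
  have [->|/fk <-] := eqVneq (f A) 0; first by rewrite mulr0 big1.
  by rewrite sumr_const -mulr_natl natz.
rewrite [RHS](reindex_onto (fun A => x |: A) (fun A => A :\ x)) /=; last first.
  by move=> A xA; rewrite setD1K.
apply: eq_bigl => A; rewrite setU11 /=.
by apply/idP/eqP => [xA|<-]; [rewrite setU1K | rewrite setD11].
Qed.

(** * Two-row tabloids as subsets *)

Lemma pairs_exist (T : finType) (b : nat) (r : seq T) : (b.*2 <= size r)%N ->
  exists2 l : seq (T * T), size l = b & pair_entries l = take b.*2 r.
Proof.
elim: b r => [|b IH] r; first by exists [::]; rewrite // take0.
case: r => [|x [|y r]] //=; rewrite !ltnS => /IH[l lb lr].
by exists ((x, y) :: l); rewrite /= ?lb ?lr.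
Qed.

Lemma index_pair_entries (T : finType) (l : seq (T * T)) (r : seq T) x y :
    uniq (pair_entries l) -> (x, y) \in l ->
  exists2 j, (j < size l)%N &
    index x (pair_entries l ++ r) = j.*2 /\ index y (pair_entries l ++ r) =
      j.*2.+1.
Proof.
elim: l => [//|[u v] l IH] /= /and3P[];
  rewrite !inE negb_or => /andP[uv ul] vl Ul.
case/orP => [/eqP[-> ->]|xyl].
  by exists 0%N => //; rewrite eqxx (negbTE uv) eqxx.
have [j lt_j [Ex Ey]] := IH Ul xyl; have /andP[xl yl] := mem_pair_entries xyl.
have ne z w : z \in pair_entries l -> w \notin pair_entries l -> (w == z) =
  false.
  by move=> zl wl; apply: contraNF wl => /eqP->.
by exists j.+1; rewrite // !ne // Ex Ey.
Qed.

Section TwoRows.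
Variables a b : nat.
Hypothesis ba : (b <= a)%N.
Local Notation lam := [:: a; b].
Local Notation n := (sumn lam).
Implicit Types (t : tableau lam) (s : 'S_n) (X : tabloid lam) (A B : {set
  'I_n}).

Lemma two_row_node (r c : nat) : (r < 2)%N -> (c < nth 0%N lam r)%N ->
  exists d : node lam, node_row d = r :> nat /\ node_col d = c.
Proof.
move=> r2 cr.
by exists (Tagged (fun i : 'I_(size lam) => 'I_(nth 0%N lam i))
   (Ordinal (cr : (c < nth 0%N lam (Ordinal (r2 : (r < size lam)%N)))%N))).
Qed.

Lemma two_row_size : n = (a + b)%N.
Proof. by rewrite /= addn0. Qed.

(** List the letters as x0, y0, x1, y1, and so on through l, and then the other
    ones: the pairs fill the first b columns from top to bottom, and the other
    letters the end of the first row. *)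
Lemma tableau_of_pairs (l : seq ('I_n * 'I_n)) : uniq (pair_entries l) -> size
  l = b ->
  exists t, forall x y, (x, y) \in l ->
    [/\ node_row (val t x) = 0%N :> nat, node_row (val t y) = 1%N :> nat &
        node_col (val t x) = node_col (val t y)].
Proof.
move=> ul lb; pose r := [seq x <- enum 'I_n | x \notin pair_entries l].
pose L := pair_entries l ++ r.
have Lmem x : x \in L by rewrite mem_cat mem_filter mem_enum andbT orbN.
have uL : uniq L.
  rewrite cat_uniq ul filter_uniq ?enum_uniq // andbT; apply/hasPn => x.
  by rewrite mem_filter => /andP[].
have sL : size L = n.
  by rewrite -(card_uniqP uL) -[RHS]card_ord; apply: eq_card => x; rewrite Lmem.
have idx k : (index k L < a + b)%N.
  by apply: (@leq_trans (size L)); rewrite ?index_mem ?Lmem // sL two_row_size.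
pose row k := if (index k L < b.*2)%N then nat_of_bool (odd (index k L)) else
  0%N.
pose col k := if (index k L < b.*2)%N then (index k L)./2 else (index k L -
  b)%N.
have /choice[f fP] (k : 'I_n) :
    exists d : node lam, node_row d = row k :> nat /\ node_col d = col k.
  apply: two_row_node; first by rewrite /row; case: ifP => //; case: odd.
  have := odd_double_half (index k L); rewrite /row /col.
  move: (index k L) (idx k) => i lt_i; case: (ltnP i b.*2) => lt_ib;
    last by move=> _ /=; lia.
  by case: (odd i) => E /=; move: E lt_ib; rewrite -!addnn; lia.
have f_inj : injective (finfun f).
  move=> k k'; rewrite !ffunE => ff.
  have [rk ck] := fP k; have [rk' ck'] := fP k'.
  have : row k = row k' by rewrite -rk -rk' ff.
  have : col k = col k' by rewrite -ck -ck' ff.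
  have := odd_double_half (index k L); have := odd_double_half (index k' L).
  rewrite /row /col => E1 E2 Ec Er.
  have Ei : index k L = index k' L.
    move: (index k L) (index k' L) Ec Er E1 E2 => i i'.
    case: (ltnP i b.*2) => Hi; case: (ltnP i' b.*2) => Hi';
      rewrite -?addnn in Hi Hi' *;
    by case: (odd i); case: (odd i'); rewrite /= -?addnn; lia.
  by rewrite -(nth_index k (Lmem k)) Ei nth_index.
have f_injb : injectiveb (finfun f) by apply/injectiveP.
exists (exist _ (finfun f) f_injb) => x y xyl /=; rewrite !ffunE.
have [rx cx] := fP x; have [ry cy] := fP y.
have [j lt_j [Ex Ey]] := index_pair_entries r ul xyl.
have lt_x : (j.*2 < b.*2)%N by rewrite ltn_double -lb.
have lt_y : (j.*2.+1 < b.*2)%N by rewrite -doubleS -lb ltn_Sdouble in lt_x *;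
  lia.
rewrite rx ry cx cy /row /col -/L Ex Ey lt_x lt_y /= odd_double; split=> //.
by rewrite uphalf_double doubleK.
Qed.

Lemma tableau_exists : exists2 l : seq ('I_n * 'I_n), uniq (pair_entries l) /\
  size l = b &
  exists t, forall x y, (x, y) \in l ->
    [/\ node_row (val t x) = 0%N :> nat, node_row (val t y) = 1%N :> nat &
        node_col (val t x) = node_col (val t y)].
Proof.
have [|l lb lE] := @pairs_exist 'I_n b (enum 'I_n).
  by rewrite size_enum_ord two_row_size; lia.
have ul : uniq (pair_entries l) by rewrite lE take_uniq ?enum_uniq.
by exists l => //; apply: tableau_of_pairs.
Qed.

(** A two-row tabloid is determined by this set of b letters. *)
Definition second_row X : {set 'I_n} := [set k | val X k == 1%N :> nat].

Lemma second_row_inj : injective second_row.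
Proof.
move=> X Y /setP XY; apply/val_inj/ffunP => k; apply/val_inj.
have := XY k; rewrite !inE.
by case: (val X k) (val Y k) => [[|[|?]] //= ?] [[|[|?]] //= ?].
Qed.

Lemma second_row_act s X : second_row (tabloid_act s X) = s @^-1: second_row X.
Proof. by apply/setP => k; rewrite !inE ffunE. Qed.

Lemma tabloid_ofP X : exists t, X = tabloid_of t.
Proof. by have /existsP[t /eqP tX] := valP X; exists t; apply/val_inj. Qed.

Lemma card_second_row X : #|second_row X| = b.
Proof.
have [t ->] := tabloid_ofP X; rewrite -sum1_card big_mkcond /=.
rewrite (eq_bigr (fun k => (node_row (val t k) == 1%N :> nat) : nat));
  last first.
  by move=> k _; rewrite inE !ffunE; case: eqP.
rewrite (sum_tableau t (fun d => (node_row d == 1%N :> nat) : nat)) sum_node.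
rewrite !big_ord_recl big_ord0 /= big1 //= add0n addn0.
by rewrite sum1_card card_ord.
Qed.

Lemma second_row_surj A : #|A| = b -> exists X, second_row X = A.
Proof.
move=> Ab; have [_ _ [t _]] := tableau_exists.
have [|s sA] := @preim_subset_trans _ (second_row (tabloid_of t)) A.
  by rewrite card_second_row.
by exists (tabloid_act s (tabloid_of t)); rewrite second_row_act.
Qed.

Lemma tabloid_act_trans X Y : exists s, tabloid_act s X = Y.
Proof.
have [|s sE] := @preim_subset_trans _ (second_row X) (second_row Y).
  by rewrite !card_second_row.
by exists s; apply: second_row_inj; rewrite second_row_act.
Qed.

Definition extend_tabloid (v : perm_module lam) A : int :=
  \sum_X (second_row X == A)%:Z * v X.

Lemma extend_second_row v X : extend_tabloid v (second_row X) = v X.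
Proof.
rewrite /extend_tabloid (bigD1 X) //= eqxx mul1r big1 ?addr0 // => Y YX.
by rewrite (inj_eq second_row_inj) (negbTE YX) mul0r.
Qed.

Lemma extend_tabloid_homogeneous v : homogeneous b (extend_tabloid v).
Proof.
move=> A; apply: contraNeq => Ab; rewrite /extend_tabloid big1 // => X _.
by case: eqP => [E|]; [rewrite -E card_second_row eqxx in Ab | rewrite mul0r].
Qed.

Lemma homogeneous_ext (f g : {set 'I_n} -> int) : homogeneous b f ->
  homogeneous b g ->
  (forall X, f (second_row X) = g (second_row X)) -> f =1 g.
Proof.
move=> fb gb fg A; have [/second_row_surj[X <-]|Ab] := eqVneq #|A| b;
  first exact: fg.
have -> : f A = 0 by apply: contraNeq Ab => /fb ->.
by apply/esym; apply: contraNeq Ab => /gb ->.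
Qed.

Lemma extendB v w A : extend_tabloid (v - w) A = extend_tabloid v A -
  extend_tabloid w A.
Proof. by rewrite /extend_tabloid -sumrB; apply: eq_bigr => X _;
  rewrite !ffunE mulrBr. Qed.

Definition restrict_tabloid (f : {set 'I_n} -> int) : perm_module lam :=
  [ffun X => f (second_row X)].

Lemma extend_restrict f : homogeneous b f -> extend_tabloid (restrict_tabloid
  f) =1 f.
Proof.
move=> fb; apply: homogeneous_ext => //;
  first exact: extend_tabloid_homogeneous.
by move=> X; rewrite extend_second_row ffunE.
Qed.

Lemma restrict_extend v : restrict_tabloid (extend_tabloid v) = v.
Proof. by apply/ffunP => X; rewrite ffunE extend_second_row. Qed.

End TwoRows.

(** * Two-row Specht lattices as kernels *)

Section TwoRowSpecht.
Variables a b : nat.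
Hypothesis ba : (b <= a)%N.
Local Notation lam := [:: a; b].
Local Notation n := (sumn lam).
Implicit Types (t : tableau lam) (s : 'S_n) (X : tabloid lam) (A B : {set
  'I_n}).

Lemma extend_perm_module_act s (v : perm_module lam) A :
  extend_tabloid (perm_module_act s v) (s @^-1: A) = extend_tabloid v A.
Proof.
rewrite /extend_tabloid (reindex (tabloid_act s)) /=.
  apply: eq_bigr => X _;
    rewrite ffunE -tabloid_actM mulVg tabloid_act1 second_row_act.
  congr (Posz (nat_of_bool _) * _).
  apply/eqP/eqP => [/setP E|-> //]; apply/setP => k.
  by have := E (s^-1 k)%g; rewrite !inE permKV.
by exists (tabloid_act s^-1%g) => X _;
  rewrite -tabloid_actM ?mulVg ?mulgV tabloid_act1.
Qed.

Lemma down_act s (f g : {set 'I_n} -> int) :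
  (forall A, g (s @^-1: A) = f A) -> forall B, down g (s @^-1: B) = down f B.
Proof.
move=> gf B; rewrite /down (reindex_inj (@perm_inj _ s^-1%g)) /=.
apply: eq_big => [x|x _]; first by rewrite inE permKV.
rewrite -gf; congr g; apply/setP => k; rewrite !inE; congr (_ || _).
by rewrite -(inj_eq (@perm_inj _ s)) permKV.
Qed.

Lemma extend_polytabloid_antisymmetric t (l : seq ('I_n * 'I_n)) :
    uniq (pair_entries l) ->
    (forall x y, (x, y) \in l -> node_col (val t x) = node_col (val t y)) ->
  antisymmetric_along l (extend_tabloid (polytabloid t)).
Proof.
move=> ul tl x y xyl A.
have xy := pair_neq ul xyl.
have sC : tperm x y \in column_stabiliser t.
  by apply/column_stabiliserP => k; case: tpermP => [->|->|//];
    rewrite (tl x y).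
have key X : extend_tabloid (polytabloid t) (tperm x y @^-1: second_row X)
    = - extend_tabloid (polytabloid t) (second_row X).
  rewrite -second_row_act !extend_second_row (polytabloid_column X sC).
  by rewrite odd_tperm xy expr1 mulN1r.
have [/(second_row_surj ba)[X <-] //|Ab] := eqVneq #|A| b.
have out (C : {set 'I_n}) : #|C| != b -> extend_tabloid (polytabloid t) C = 0.
  by move=> Cb; apply: contraNeq Cb => /extend_tabloid_homogeneous->.
rewrite !out ?oppr0 // card_preimset //; exact: perm_inj.
Qed.

(** For a tableau whose first b columns are the pairs of l, both functions are
    antisymmetric along l, so they are compared at one set. *)
Lemma alternating_polytabloid (l : seq ('I_n * 'I_n)) (f : {set 'I_n} -> int) :
    uniq (pair_entries l) -> size l = b -> alternating l f ->
  exists t z, restrict_tabloid f = polytabloid t *~ z.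
Proof.
move=> ul lb [fh fl _]; have [t tP] := tableau_of_pairs ba ul lb.
pose A0 := second_row (tabloid_of t); pose z := f A0.
have tcol x y : (x, y) \in l -> node_col (val t x) = node_col (val t y).
  by case/tP.
have inA0 k : (k \in A0) = (node_row (val t k) == 1%N :> nat) by rewrite inE
  !ffunE.
have snd_uniq : uniq [seq q.2 | q <- l].
  elim: l ul {lb fh fl tP tcol} => //= -[x y] l IH /and3P[_ yl ul] /=.
  rewrite IH // andbT; apply: contra yl => /mapP[[u v] uvl /= ->].
  by case/andP: (mem_pair_entries uvl).
have snd_A0 : [seq q.2 | q <- l] =i A0.
  apply/subset_cardP; first by rewrite (card_uniqP snd_uniq) size_map lb
    card_second_row.
  apply/subsetP => y /mapP[[x' y'] xyl /= ->].
  by rewrite inA0; case: (tP _ _ xyl) => _ ->.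
exists t, z; apply/ffunP => X; rewrite ffunE ffunMzE -extend_second_row.
pose h A := f A - extend_tabloid (polytabloid t) A * z.
suff : h (second_row X) = 0.
  by rewrite /h => /eqP; rewrite subr_eq0 => /eqP ->; rewrite -mulrzr intz.
have eanti := extend_polytabloid_antisymmetric ul tcol.
have A0b : #|A0| = size l by rewrite card_second_row.
apply: (antisymmetric_determined _ _ A0b) => [x y xyl A|A|x y xyl|y|].
- by rewrite /h fl // eanti //; ring.
- rewrite /h; have [->|/fh //] := eqVneq (f A) 0;
  rewrite sub0r oppr_eq0 mulf_eq0.
  by case/norP => /extend_tabloid_homogeneous ->.
- by rewrite inA0; case: (tP _ _ xyl) => _ ->.
- rewrite -snd_A0 => /mapP[[x y'] xyl /= ->]; exists x => //.
  by rewrite inA0; case: (tP _ _ xyl) => ->.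
- by rewrite /h extend_second_row polytabloid_self mul1r subrr.
Qed.

(** James' kernel theorem for two rows.  Polytabloids are antisymmetric in their
    columns, hence in the kernel; conversely the kernel is generated by
    alternating functions, and these are multiples of polytabloids. *)
Lemma two_row_kernel (v : perm_module lam) :
  v \in @specht_pred lam <-> forall B, down (extend_tabloid v) B = 0.
Proof.
split=> [/asboolP[c ->] B|vd].
  have [l [ul lb] [t0 t0P]] := tableau_exists ba.
  have poly0 t A : down (extend_tabloid (polytabloid t)) A = 0.
    have [s ->] := tableau_trans t0 t; rewrite -perm_module_act_polytabloid.
    pose A' := (s^-1)%g @^-1: A.
    have -> : A = s @^-1: A' by apply/setP => k; rewrite !inE permK.
    rewrite (down_act (extend_perm_module_act s (polytabloid t0))).
    apply: (down_antisymmetric A' ul); last first.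
      by rewrite lb; apply: extend_tabloid_homogeneous.
    by apply: extend_polytabloid_antisymmetric ul _ => x y /t0P[].
  have extend_sum A : extend_tabloid (\sum_t polytabloid t *~ c t) A
      = \sum_t c t * extend_tabloid (polytabloid t) A.
    rewrite /extend_tabloid; under [RHS]eq_bigr do rewrite mulr_sumr.
    rewrite exchange_big; apply: eq_bigr => X _ /=; rewrite sum_ffunE mulr_sumr.
    by apply: eq_bigr => t _; rewrite ffunMzE -mulrzr intz; ring.
  rewrite (down_ext B extend_sum) /down exchange_big big1 //= => t _.
  by have := poly0 t B; rewrite /down -mulr_sumr => ->; rewrite mulr0.
rewrite -(restrict_extend v).
apply: (@down_kernel_generated _ setT b (extend_tabloid v)
  (fun f => restrict_tabloid f \in @specht_pred lam)) => //.
- by move=> A /extend_tabloid_homogeneous Ab; rewrite subsetT.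
- move=> f g fg; have -> : restrict_tabloid f = restrict_tabloid g; last by [].
  by apply/ffunP => X; rewrite !ffunE.
- exact: rpred0.
- move=> f g fS gS; rewrite (_ : restrict_tabloid _ = restrict_tabloid f -
  restrict_tabloid g).
    exact: rpredB.
  by apply/ffunP => X; rewrite !ffunE.
- move=> l f lf ul lb _; have [t [z ->]] := alternating_polytabloid ul lb lf.
  exact: polytabloid_specht.
Qed.

End TwoRowSpecht.

(** * The p-torsion for the partitions (mp + s, p) *)

Section TwoRowSequence.
Variables a b : nat.
Hypothesis ba : (b <= a)%N.
Local Notation lam := [:: a; b].
Local Notation n := (sumn lam).

Definition tabloid_module : gmodule 'S_n :=
  permutation_gmodule (@tabloid_act1 lam) (@tabloid_actM lam).
Definition subset_module : gmodule 'S_n := ksubset_module 'I_n b.-1.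

Definition specht_inclusion (v : specht lam) : tabloid_module := specht_val v.
Lemma specht_inclusion_is_zmod_morphism : zmod_morphism specht_inclusion.
Proof. exact: (raddfB (val : specht_type lam -> perm_module lam)). Qed.
HB.instance Definition _ := GRing.isZmodMorphism.Build (specht lam)
  tabloid_module
  specht_inclusion specht_inclusion_is_zmod_morphism.

Definition restriction (v : tabloid_module) : subset_module :=
  [ffun B : ksubset 'I_n b.-1 => down (extend_tabloid (v : perm_module lam))
    (val B)].
Lemma restriction_is_zmod_morphism : zmod_morphism restriction.
Proof.
move=> v w; apply/ffunP => B; rewrite !ffunE -downB.
by apply: down_ext => A; rewrite extendB.
Qed.
HB.instance Definition _ := GRing.isZmodMorphism.Build tabloid_module
  subset_module
  restriction restriction_is_zmod_morphism.

Lemma restriction_act s v : restriction (gact s v) = gact s (restriction v).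
Proof.
apply/ffunP => B; rewrite !ffunE /=.
rewrite -(down_act (extend_perm_module_act s v)); congr (down _ _).
by apply/setP => k; rewrite !inE permK.
Qed.

Hypothesis b_gt0 : (0 < b)%N.

Lemma down_extend (v : tabloid_module) :
  down (extend_tabloid (v : perm_module lam)) =1 extend_ksubset (restriction v).
Proof.
have dh : homogeneous b.-1 (down (extend_tabloid (v : perm_module lam))).
  by apply: down_homogeneous; rewrite prednK //;
    apply: extend_tabloid_homogeneous.
move=> B; have [Bb|Bb] := eqVneq #|B| b.-1.
  have /eqP Bb' := Bb.
  by rewrite -[B]/(val (exist (fun A : {set 'I_n} => #|A| == b.-1) B Bb'))
    extend_ksubset_val ffunE.
have -> : down (extend_tabloid (v : perm_module lam)) B = 0.
  by apply: contraNeq Bb => /dh ->.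
by apply/esym; apply: contraNeq Bb => /extend_ksubset_homogeneous ->.
Qed.

Lemma restriction_kernel (v : tabloid_module) :
  restriction v = 0 -> exists u, specht_inclusion u = v.
Proof.
move=> v0; have vS : (v : perm_module lam) \in @specht_pred lam.
  apply/(two_row_kernel ba) => B; rewrite down_extend v0.
  by rewrite /extend_ksubset; case: insub => //= C; rewrite ffunE.
by exists (MkSpecht vS).
Qed.

Lemma restriction_inclusion u : restriction (specht_inclusion u) = 0.
Proof.
apply/ffunP => B; rewrite !ffunE.
by have /(two_row_kernel ba) -> := valP u.
Qed.

Lemma sum_restriction (v : tabloid_module) : (b %| ksubset_sum (restriction
  v))%Z.
Proof.
rewrite -ksubset_sum_extend -(eq_bigr _ (fun B _ => down_extend v B)).
by rewrite (sum_down (@extend_tabloid_homogeneous _ _ v)) dvdz_mulr.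
Qed.

Lemma restriction_image (y : subset_module) : odd b -> (b %| ksubset_sum y)%Z ->
  exists v, restriction v = y *+ (b.-1)`!.
Proof.
move=> b_odd by_; have T_big : (b.-1.*2 < #|'I_n|)%N.
  by rewrite card_ord two_row_size -addnn; lia.
have b1_even : ~~ odd b.-1 by move: b_odd; rewrite -{1}(prednK b_gt0).
have [|w wb wE] := reach_of_sum b1_even T_big (@extend_ksubset_homogeneous _ _
  y).
  by rewrite prednK // ksubset_sum_extend.
rewrite prednK // in wb.
exists (restrict_tabloid w); apply/ffunP => B; rewrite ffunE ffunMnE.
rewrite (down_ext _ (extend_restrict ba wb)) wE extend_ksubset_val.
by rewrite -mulr_natl natz.
Qed.

Lemma tabloid_inhabited : inhabited (tabloid lam).
Proof. by have [_ _ [t _]] := tableau_exists ba; exists;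
  exact: tabloid_of t. Qed.

Lemma tabloid_H1_trivial : H1_trivial tabloid_module.
Proof.
have [X0] := tabloid_inhabited.
by apply: (permutation_H1_trivial (w0 := X0)); apply: tabloid_act_trans.
Qed.

Lemma tabloid_H2_torsion_free p : prime p -> (2 < p)%N ->
  H2_torsion_free p tabloid_module.
Proof.
move=> p_pr p_gt2; have [X0] := tabloid_inhabited.
apply: (permutation_H2_torsion_free (w0 := X0)) => [X||phi phiP s sX].
- exact: tabloid_act_trans.
- exact: prime_gt0.
apply: (set_stabiliser_hom_trivial (A := second_row X0) p_pr p_gt2).
  move=> u w uA wA; apply: phiP; apply: second_row_inj;
    by rewrite second_row_act.
by rewrite -second_row_act sX.
Qed.

Lemma ksubset_inhabited : inhabited (ksubset 'I_n b.-1).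
Proof.
have [|B _ /eqP Bb] := @subset_of_card_exists 'I_n setT b.-1.
  by rewrite cardsT card_ord two_row_size; lia.
by exists; exact: exist _ B Bb.
Qed.

Lemma subset_H1_trivial : H1_trivial subset_module.
Proof.
have [B0] := ksubset_inhabited.
by apply: (permutation_H1_trivial (w0 := B0)); apply: ksubset_act_trans.
Qed.

End TwoRowSequence.

Lemma prime_coprime_fact (p k : nat) : prime p -> (k < p)%N -> coprime p k`!.
Proof.
move=> p_pr; elim: k => [|k IH] lt_kp; first by rewrite coprimen1.
rewrite factS coprimeMr IH ?andbT; last exact: ltnW.
by rewrite prime_coprime // gtnNdvd.
Qed.

(** Among the p - 1 consecutive factors of the falling factorial, one is
    divisible by p unless the first one is congruent to p - 1. *)
Lemma dvdn_bin_pred (p m s : nat) : prime p -> (s < p)%N ->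
  (p %| 'C(m * p + s, p.-1))%N = (s < p.-1)%N.
Proof.
move=> p_pr lt_sp; have p_gt0 := prime_gt0 p_pr.
have -> : (p %| 'C(m * p + s, p.-1))%N = (p %| (m * p + s) ^_ p.-1)%N.
  rewrite -bin_ffact Euclid_dvdM // orb_idr // => pf.
  have := prime_coprime_fact p_pr (_ : p.-1 < p)%N.
  by rewrite prime_coprime // pf ltn_predL p_gt0 => /(_ isT).
rewrite ffact_prod Euclid_dvd_prod // big_has_cond.
apply/hasP/idP => [[i _ /=]|lt_s]; last first.
  by exists (Ordinal lt_s); rewrite ?mem_index_enum //= addnK dvdn_mull.
have lt_i := ltn_ord i; apply: contraTT; rewrite -leqNgt => ge_s.
have -> : s = p.-1 by lia.
have -> : (m * p + p.-1 - i = m * p + (p.-1 - i))%N by rewrite addnBA // ltnW.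
by rewrite dvdn_addr ?dvdn_mull // gtnNdvd //; lia.
Qed.

Section TwoRowRank.
Variables (p m s : nat).
Hypotheses (p_pr : prime p) (p_gt2 : (2 < p)%N) (m_gt0 : (0 < m)%N) (lt_sp : (s
  < p)%N).
Local Notation a := (m * p + s)%N.
Local Notation lam := [:: a; p].

Let p_gt0 : (0 < p)%N := prime_gt0 p_pr.
Let pa : (p <= a)%N.
Proof. by apply: (leq_trans _ (leq_addr _ _)); rewrite leq_pmull. Qed.
Let pN : coprime p (p.-1)`!.
Proof. by apply: prime_coprime_fact; rewrite // ltn_predL. Qed.
Let p_odd : odd p.
Proof. by case: (even_prime p_pr) => // E; move: p_gt2; rewrite E. Qed.

Let card_subsets : 'C(#|'I_(sumn lam)|, p.-1) = 'C(m.+1 * p + s, p.-1).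
Proof. by rewrite card_ord two_row_size mulSn addnC addnA. Qed.

(** The multiples of the sum of all (p-1)-subsets, which are the invariants, have
    augmentation divisible by p. *)
Lemma two_row_prank1 : (s < p.-1)%N -> has_prank p (H2 (specht lam)) 1.
Proof.
move=> lt_s; have [B0] := ksubset_inhabited pa p_gt0.
pose y0 : subset_module a p := [ffun B => (B == B0)%:Z].
apply: (@connecting_prank1 _ (specht lam) (tabloid_module a p) (subset_module a
  p)
  (@specht_inclusion a p) (@restriction a p)
  (@ksubset_sum _ p.-1) _ _ _ _ _ _ p (p.-1)`! p_pr pN _ _ _ _ _ y0).
- exact: val_inj.
- by [].
- exact: restriction_act.
- exact: restriction_inclusion.
- exact: restriction_kernel.
- exact: ksubset_sum_act.
- exact: sum_restriction.
- by move=> y py; apply: restriction_image.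
- exact: tabloid_H1_trivial.
- exact: subset_H1_trivial.
- exact: tabloid_H2_torsion_free.
- rewrite /= /ksubset_sum (bigD1 B0) //= ffunE eqxx big1 // => B /negbTE BB.
  by rewrite ffunE BB.
- move=> z /ksubset_sum_invariant; apply: dvdz_trans.
  by rewrite card_subsets dvdzE /= dvdn_bin_pred.
Qed.

(** The sum of all (p-1)-subsets is an invariant of augmentation prime to p. *)
Lemma two_row_torsion_free : s = p.-1 -> H2_torsion_free p (specht lam).
Proof.
move=> sE.
pose z : subset_module a p := [ffun B => 1].
apply: (@connecting_torsion_free _ (specht lam) (tabloid_module a p)
  (subset_module a p)
  (@specht_inclusion a p) (@restriction a p)
  (@ksubset_sum _ p.-1) _ _ _ _ _ p (p.-1)`! p_pr pN _ _ _ z).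
- exact: val_inj.
- by [].
- exact: restriction_act.
- exact: restriction_inclusion.
- exact: restriction_kernel.
- by move=> y py; apply: restriction_image.
- exact: subset_H1_trivial.
- exact: tabloid_H2_torsion_free.
- by move=> g; apply/ffunP => B; rewrite !ffunE.
- rewrite /= /ksubset_sum (eq_bigr (fun=> 1)) => [|B _]; last by rewrite ffunE.
  rewrite sumr_const card_ksubset natz dvdzE /= card_subsets dvdn_bin_pred //.
  by rewrite sE ltnn.
Qed.

End TwoRowRank.

(** * Paths *)

Lemma incr_nth_two_rows (a b i : nat) : is_partition (incr_nth [:: a; b] i) ->
  [\/ incr_nth [:: a; b] i = [:: a.+1; b],
      incr_nth [:: a; b] i = [:: a; b.+1] /\ (b < a)%N |
      incr_nth [:: a; b] i = [:: a; b; 1%N]].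
Proof.
case: i => [|[|[|i]]] /= part; [exact: Or31 | apply: Or32 | exact: Or33 |].
  by split=> //; case/andP: part => /=; rewrite andbT.
by case/andP: part => _; rewrite !inE eqxx !orbT.
Qed.

Theorem lemma6p8 (p m : nat) (p_prime : prime p) (p_gt2 : (2 < p)%N)
    (m_ge1 : (1 <= m)%N) :
  (forall P : nat -> seq nat,
      C2_path p P -> P 0%N = [:: (m * p)%N; p] ->
      (forall s : nat, (s <= p - 2)%N -> P s = [:: (m * p + s)%N; p]) /\
      P (p - 1)%N = [:: (m * p + p - 2)%N; p; 1%N]) /\
  (forall s : nat, (s <= p - 2)%N ->
      has_prank p (H2 (specht [:: (m * p + s)%N; p])) 1).
Proof.
have p_gt0 := prime_gt0 p_prime.
have le_pa s : (p <= m * p + s)%N by rewrite (leq_trans _ (leq_addr _ _))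
  ?leq_pmull.
split=> [P [_ arrows _] P0|s le_s]; last by apply: two_row_prank1 => //; lia.
(* The candidates that are not listed here have no p-torsion in degree two. *)
have next s : (s <= p - 2)%N -> P s = [:: (m * p + s)%N; p] ->
    P s.+1 = if (s < p - 2)%N then [:: (m * p + s.+1)%N; p]
             else [:: (m * p + s)%N; p; 1%N].
  move=> le_s Ps; have [_ [part ord] [i Ei]] := arrows s.
  rewrite {}Ei Ps in part ord *.
  have [E|[E lt_pa]|E] := incr_nth_two_rows part; rewrite {}E in ord *.
  - rewrite addnS; case: ltnP => // ge_s.
    have [x x0 px] := dvd_order_torsion p_prime ord.
    case/eqP: x0; move: x px; rewrite -addnS.
    by apply: two_row_torsion_free => //; lia.
  - case: (@two_row_not_dvd_order p (m * p + s) p.+1) => //.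
    rewrite Euclid_dvdM // negb_or -addn1 dvdn_addr // gtnNdvd ?(ltn_trans _
      p_gt2) //=.
    by rewrite -addnS dvdn_addr ?dvdn_mull // gtnNdvd //; lia.
  - case: ltnP => // lt_s.
    case: (@three_row_not_dvd_order p (m * p + s) p) => //.
    rewrite Euclid_dvdM // negb_or -[p.+1]addn1 dvdn_addr // (gtnNdvd _ (ltnW
      p_gt2)) // andbT.
    by rewrite -!addnS dvdn_addr ?dvdn_mull // gtnNdvd //; lia.
have initial s : (s <= p - 2)%N -> P s = [:: (m * p + s)%N; p].
  elim: s => [|s IH] le_s; first by rewrite P0 addn0.
  by rewrite next ?le_s //; [lia | apply: IH; lia].
split=> //; have -> : (p - 1 = (p - 2).+1)%N by lia.
rewrite (next _ (leqnn _) (initial _ (leqnn _))) ltnn.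
by rewrite addnBA // ltnW.
Qed.
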